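(* Let $k$ be a field, let $R=k[x_1,\ldots,x_n]$, and let $\Delta$ be a simplicial tree whose vertices are among $x_1,\ldots,x_n$, with facet ideal $\mathcal{F}(\Delta)\subseteq R$. If $\Delta$ is unmixed, then the quotient ring $R/\mathcal{F}(\Delta)$ is Cohen-Macaulay.
   Context: A simplicial complex $\Delta$ is a collection of subsets (faces) of a finite nonempty vertex set, closed under taking subsets and containing every singleton of a vertex; its facets are its maximal faces. A subcollection of $\Delta$ is a simplicial complex whose set of facets is a subset of the set of facets of $\Delta$. Vertices are identified with variables. The facet ideal $\mathcal{F}(\Delta)\subseteq R$ is the ideal generated by the square-free monomials $\prod_{x\in F}x$, where $F$ ranges over the facets of $\Delta$. $\Delta$ is connected if for any two facets $F,F'$ there is a sequence of facets starting at $F$ and ending at $F'$ in which consecutive facets have nonempty intersection. A facet $F$ of $\Delta$ is a leaf if either $F$ is the only facet of $\Delta$, or there is a facet $G\neq F$ of $\Delta$ such that $F\cap F'\subseteq G$ for every facet $F'\ne F$ of $\Delta$. A tree is a connected simplicial complex every nonempty subcollection of which has a leaf. A vertex cover of $\Delta$ is a set of vertices that intersects every facet of $\Delta$; a minimal vertex cover is one minimal under inclusion. $\Delta$ is unmixed if all of its minimal vertex covers have the same cardinality. *)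

(* Defs.v *)
From HB Require Import structures.
From mathcomp Require Import all_boot all_order all_algebra.
From mathcomp Require Import boolp.
From mathcomp Require Import mpoly.

Set Implicit Arguments.
Unset Strict Implicit.
Unset Printing Implicit Defensive.

Import GRing.Theory.
Local Open Scope ring_scope.

Record simplicial_complex (T : finType) := SimplicialComplex {
  vertices : {set T};
  faces : {set {set T}};
  vertices_neq0 : vertices != set0;
  face_sub_vertices : forall F : {set T}, F \in faces -> F \subset vertices;
  face_closed : forall F G : {set T}, F \in faces -> G \subset F -> G \in faces;
  vertex_face : forall v, v \in vertices -> [set v] \in faces
}.

Section Combinatorics.
Variable T : finType.
Implicit Types (D E : simplicial_complex T) (F G H C : {set T}).

Definition facets D : {set {set T}} := [set F | maxset (mem (faces D)) F].

Definition subcollection E D : bool := facets E \subset facets D.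

Definition connected D : Prop :=
  forall F G, F \in facets D -> G \in facets D ->
  exists p : seq {set T},
    [/\ {subset p <= facets D},
        path (fun A B : {set T} => A :&: B != set0) F p
      & last F p = G].

Definition leaf D F : Prop :=
  F \in facets D /\
  (facets D = [set F] \/
   exists2 G, G \in facets D & G != F /\
     forall H, H \in facets D -> H != F -> F :&: H \subset G).

Definition tree D : Prop :=
  connected D /\
  forall E, subcollection E D -> facets E != set0 -> exists F, leaf E F.

Definition vertex_cover D C : bool :=
  (C \subset vertices D) && [forall F in facets D, C :&: F != set0].

Definition minimal_vertex_cover D C : bool := minset (vertex_cover D) C.

Definition unmixed D : Prop :=
  forall C C', minimal_vertex_cover D C -> minimal_vertex_cover D C' ->
  #|C| = #|C'|.

Lemma facet_neq0 D F : F \in facets D -> F != set0.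
Proof.
rewrite inE => /maxsetP [_ maxF]; apply/eqP => F0.
have /set0Pn [v vD] := vertices_neq0 D.
have /setP /(_ v) : [set v] = F.
  by apply: maxF; rewrite ?F0 ?sub0set //; apply: vertex_face.
by rewrite F0 !inE eqxx.
Qed.

End Combinatorics.

(* Subsets of a ring are boolean predicates; with the classical axioms of     *)
(* boolp every subset is of this form. As in ring_quotient, idealr_closed     *)
(* means "proper ideal".                                                      *)
Section CommutativeAlgebra.
Variable A : comNzRingType.
Implicit Types (I J P M : {pred A}) (s : seq A).

Definition ideal_span s : {pred A} :=
  fun x => `[< exists c : nat -> A, x = \sum_(i < size s) c i * s`_i >].

(* The improper ideal is generated by 1, so proper ideals suffice. *)
Definition noetherian : Prop :=
  forall I, idealr_closed I -> exists s, I =i ideal_span s.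

Definition prime_ideal P : Prop := idealr_closed P /\ prime_idealr_closed P.

Definition maximal_ideal M : Prop :=
  idealr_closed M /\
  forall J, idealr_closed J -> {subset M <= J} -> {subset J <= M}.

Definition strict_subset I J : Prop :=
  {subset I <= J} /\ ~ {subset J <= I}.

(* c 0 = P is the largest prime of the chain: c d < ... < c 1 < c 0 = P. *)
Definition prime_chain_from P (d : nat) (c : nat -> {pred A}) : Prop :=
  [/\ c 0%N =i P,
      forall i, (i <= d)%N -> prime_ideal (c i)
    & forall i, (i < d)%N -> strict_subset (c i.+1) (c i)].

(* codim P = dim A_P = d *)
Definition has_codim P (d : nat) : Prop :=
  (exists c, prime_chain_from P d c) /\
  (forall e c, prime_chain_from P e c -> (e <= d)%N).

Definition regular_sequence s : Prop :=
  (forall i, (i < size s)%N -> forall y,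
     s`_i * y \in ideal_span (take i s) -> y \in ideal_span (take i s)) /\
  1 \notin ideal_span s.

(* depth(I, A) = d *)
Definition has_depth I (d : nat) : Prop :=
  (exists s, [/\ regular_sequence s, {subset s <= I} & size s = d]) /\
  (forall s, regular_sequence s -> {subset s <= I} -> (size s <= d)%N).

(* Eisenbud, Commutative Algebra, Section 18.2: a Noetherian ring with        *)
(* depth M = codim M for every maximal ideal M; equivalently, all its         *)
(* localizations at maximal ideals are Cohen-Macaulay local rings.            *)
Definition cohen_macaulay : Prop :=
  noetherian /\
  forall M, maximal_ideal M -> exists d, has_depth M d /\ has_codim M d.

End CommutativeAlgebra.

Section FacetIdeal.
Variables (k : fieldType) (n : nat) (D : simplicial_complex 'I_n).

Definition facet_monomial (F : {set 'I_n}) : {mpoly k[n]} :=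
  \prod_(i in F) 'X_i.

Definition facet_ideal : {pred {mpoly k[n]}} :=
  ideal_span [seq facet_monomial F | F <- enum (facets D)].

Lemma facet_ideal_closed : idealr_closed facet_ideal.
Proof.
split.
- apply/asboolP; exists (fun _ => 0).
  by rewrite big1 // => i _; rewrite mul0r.
- apply/negP => /asboolP []; set s := map _ _ => c /(congr1 (meval (fun=> 0))).
  have ev0 (i : 'I_(size s)) : (c i * s`_i).@[fun=> 0] = 0.
    have /mapP [F] : s`_i \in s by exact: mem_nth.
    rewrite mem_enum => /facet_neq0 /set0Pn [v vF] ->.
    rewrite mevalM /facet_monomial rmorph_prod (bigD1 v) //= mevalXU.
    by rewrite mul0r mulr0.
  rewrite meval1 raddf_sum big1 => [|i _]; last exact: ev0.
  by move/eqP; rewrite oner_eq0.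
- move=> a x y /asboolP [c ->] /asboolP [e ->].
  apply/asboolP; exists (fun i => a * c i + e i).
  rewrite mulr_sumr -big_split /=; apply: eq_bigr => i _.
  by rewrite mulrDl mulrA.
Qed.

HB.instance Definition _ :=
  isIdealr.Build {mpoly k[n]} facet_ideal facet_ideal_closed.

End FacetIdeal.

Arguments facet_monomial k {n} F.
Arguments facet_ideal k {n} D.

(* Main.v *)
Require Import Defs.
From HB Require Import structures.
From mathcomp Require Import all_boot all_order all_algebra.
From mathcomp Require Import boolp ring.
From mathcomp Require classical_sets.
From mathcomp Require Import ssrcomplements mpoly.

(** Why the theorem is true.

    Combinatorics. Let I be the facet ideal. An unmixed tree is grafted: its
    vertex set is a disjoint union of facets F_1, ..., F_r, called blocks, and
    the traces on F_i of the facets form a chain under inclusion. The blocks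
    come from the Koenig property (forest_konig): a forest has as many
    pairwise disjoint facets as it needs vertices in a cover. This follows by
    removing, again and again, a facet F some vertex of which lies in all the
    facets meeting F (forest_nest), together with these facets; such an F is a
    simplicial vertex of the intersection graph of the facets, which has no
    holes (forest_no_hole), and the common vertex is given by a Helly property
    (forest_helly). If the complex is unmixed, every minimal vertex cover has
    size r, hence one vertex in each block and none elsewhere; since every
    vertex lies in some minimal cover, the blocks cover the vertices. If two
    facets had incomparable traces on a block, an exchange argument would
    produce a third facet for which the leaf property fails (unmixed_chain).
    So each F_i can be listed in such a way that every facet meets F_i in an
    initial segment of the list.

    Depth. Let v_i be the first vertex of F_i. Put theta_j = v_i - x_j for the
    other vertices x_j of F_i, and theta_j = x_j for the variables that are
    not vertices; there are d = n - r of these. With v_i and theta_j as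
    coordinates, every facet monomial is a product of Newton polynomials v_i
    (v_i - theta_j) (v_i - theta_j') ..., monic in the v_i. The products of
    Newton polynomials form a basis of the polynomial ring R over S =
    k[theta], and I is the S-span of those basis elements whose exponent
    dominates the exponent of some facet. Hence R/I is free over S. (In other
    words, I is the polarization of a monomial ideal in the v_i that contains
    a power of each of them.) If M is a maximal ideal of R/I, Zariski's lemma
    gives monic polynomials p_j in one variable with p_j(theta_j) in M; the
    p_j(theta_j) form a regular sequence of length d in M. To see this with
    bare hands, the Newton products are combined with the products of
    p_j(theta_j)^a theta_j^b, where b < deg p_j, into a k-basis of R on which
    multiplication by p_j(theta_j) is a shift of exponents (qval_regular).

    Codimension. A prime containing a regular sequence of length s is the top
    of a chain of primes of length s (regular_sequence_chain). So the depth of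
    M is at most its codimension, and the latter is at least d. Conversely a
    prime P of R/I contains a vertex of each block, so its residue ring is a
    quotient of a polynomial ring in d variables; there d + 1 elements are
    algebraically dependent, by a count of monomials, and a nontrivial
    polynomial relation forbids a chain of length d + 1 (prime_chain_bound).
    Depth and codimension of M are both d. *)

Set Implicit Arguments.
Unset Strict Implicit.
Unset Printing Implicit Defensive.

(** * The Koenig property of simplicial forests *)

Section Forests.
Variable T : finType.
Implicit Types (E S K P : {set {set T}}) (A B F G H Z z a b : {set T}).

(** A leaf F of the family S, with a witness G. *)
Definition joint S F G :=
  [/\ F \in S, G \in S, G != F &
      forall H, H \in S -> H != F -> F :&: H \subset G].

(** The single member of a one-element family counts as a leaf, so only larger
    families matter. *)
Definition forest E : Prop :=
  forall S, S \subset E -> 1 < #|S| -> exists F G, joint S F G.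

Definition meets A B := A :&: B != set0.

Lemma meetsC A B : meets A B = meets B A.
Proof. by rewrite /meets setIC. Qed.

Lemma meetsP A B : reflect (exists2 v, v \in A & v \in B) (meets A B).
Proof.
apply: (iffP (set0Pn _)) => [[v /setIP [vA vB]]|[v vA vB]]; exists v => //.
by rewrite inE vA.
Qed.

Lemma forest_sub E S : S \subset E -> forest E -> forest S.
Proof. by move=> sSE fE S' sS'S; apply: fE; apply: subset_trans sSE. Qed.

Lemma meets_sub A B G : meets A B -> A :&: B \subset G ->
  meets A G && meets B G.
Proof.
move=> /meetsP [v vA vB] /subsetP /(_ v); rewrite inE vA vB => /(_ isT) vG.
by apply/andP; split; apply/meetsP; exists v.
Qed.

(** If A is a leaf of the family of the three sets with joint B, then A meets
    the third set inside B; the three disjuncts are the possible leaves. *)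
Lemma forest_triple E A B F : forest E -> A \in E -> B \in E -> F \in E ->
  [|| A :&: B \subset F, A :&: F \subset B | B :&: F \subset A].
Proof.
move=> fE AE BE FE.
have [->|nAB] := eqVneq A B; first by rewrite subsetIl /= orbT.
have [->|nAF] := eqVneq A F; first by rewrite subsetIl.
have [->|nBF] := eqVneq B F; first by rewrite subsetIr.
have [nBA nFA nFB] : [/\ B != A, F != A & F != B] by split; rewrite eq_sym.
have /fE : [set A; B; F] \subset E by rewrite !subUset !sub1set AE BE FE.
case; first by apply: leq_trans (subset_leq_card (subsetUl _ _)); rewrite cards2 nAB.
move=> X [Y []]; rewrite !inE -!orbA => XS YS nYX h.
have [hA hB hF] := And3 (h A) (h B) (h F).
rewrite !inE !eqxx ?orbT /= in hA hB hF.
case/or3P: XS nYX hA hB hF => /eqP ->; case/or3P: YS => /eqP ->;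
  rewrite ?eqxx // => _ hA hB hF.
- by rewrite hF ?orbT.
- by rewrite hB.
- by rewrite hF ?orbT.
- by rewrite setIC hA.
- by rewrite [B :&: F]setIC hB ?orbT.
- by rewrite [A :&: F]setIC hA ?orbT.
Qed.

(** Helly property relative to Z: to pass from S to S minus F, shrink Z to
    F :&: Z.  By forest_triple one of the three pairwise intersections of A, B
    and F equals the triple one, so the hypothesis survives. *)
Lemma forest_helly E S Z : forest E -> S \subset E -> Z != set0 ->
  (forall A B, A \in S -> B \in S -> A :&: B :&: Z != set0) ->
  exists2 v, v \in Z & forall A, A \in S -> v \in A.
Proof.
move=> fE; move: {2}#|S| (erefl #|S|) => n.
elim: n S Z => [|n IH] S Z cS sSE Z0 hS.
  have [v vZ] := set0Pn _ Z0; exists v => // A; move/eqP: cS.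
  by rewrite cards_eq0 => /eqP ->; rewrite inE.
have [F FS] : exists F, F \in S by apply/set0Pn; rewrite -card_gt0 cS.
have inE' A : A \in S -> A \in E by move/(subsetP sSE).
case: (IH (S :\ F) (F :&: Z)).
- by have := cardsD1 F S; rewrite cS FS => -[].
- by apply: subset_trans sSE; apply: subsetDl.
- by rewrite -{1}[F]setIid hS.
- move=> A B /setD1P [nAF AS] /setD1P [nBF BS].
  have key (X Y W : {set T}) : X :&: Y \subset W -> X :&: Y :&: Z != set0 ->
      X :&: Y :&: W :&: Z != set0.
    by move=> /setIidPl ->.
  rewrite setIA.
  case/or3P: (forest_triple fE (inE' _ AS) (inE' _ BS) (inE' _ FS)) => /key.
  + by apply; apply: hS.
  + by rewrite [A :&: B :&: F]setIAC; apply; apply: hS.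
  + by rewrite [_ :&: A]setIC setIA; apply; apply: hS.
- move=> v /setIP [vF vZ] hv; exists v => // A AS.
  by have [->//|nAF] := eqVneq A F; apply: hv; rewrite !inE nAF.
Qed.

(** Adjacency in the intersection graph restricted to P and to the ends a, b. *)
Definition link P a b : rel {set T} :=
  fun x y => [&& x \in a |: (b |: P), y \in a |: (b |: P) & meets x y].

Lemma link_step P a b c d : c != d -> connect (link P a b) c d ->
  exists h, [/\ h != c, h \in a |: (b |: P) & meets c h].
Proof.
move=> ncd /connectP [p]; elim: p c ncd => [|x p IHp] c ncd /=.
  by move=> _ e; rewrite e eqxx in ncd.
case/andP=> /and3P [cS xS cx] px el.
by have [exc|nxc] := eqVneq x c; [subst x; apply: IHp|exists x].
Qed.

Lemma linkC P a b x y : link P a b x y = link P a b y x.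
Proof. by rewrite /link meetsC andbCA. Qed.

(** The intersection graph of a forest is chordal.  Otherwise take z, a, b and
    a path from a to b through P, with P as small as possible.  If the leaf of
    this family were z, a or b, its joint would force a and b to meet.  So the
    leaf is some f in P, and every set of the family that meets f also meets
    its joint: f can be removed from the path. *)
Lemma forest_no_hole E P z a b : forest E -> P \subset E ->
  z \in E -> a \in E -> b \in E ->
  (forall x, x \in P -> ~~ meets x z) -> meets a z -> meets b z ->
  connect (link P a b) a b -> meets a b.
Proof.
move=> fE; move: {2}#|P| (leqnn #|P|) => n.
elim: n P => [|n IH] P cP sPE zE aE bE Pz az bz conn;
  case: (boolP (meets a b)) => // nab; exfalso.
  have nba : a != b.
    apply: contra nab => /eqP <-.
    by case/meetsP: az => v va _; apply/meetsP; exists v.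
  move: cP; rewrite leqn0 cards_eq0 => /eqP P0.
  have [h []] := link_step nba conn.
  by rewrite P0 !inE orbF => /negPf -> /= /eqP ->; rewrite (negPf nab).
have nba : a != b.
  apply: contra nab => /eqP <-.
  by case/meetsP: az => v va _; apply/meetsP; exists v.
have nza : a != z by apply: contra nab => /eqP ->; rewrite meetsC.
have nzb : b != z by apply: contra nab => /eqP ->.
have conn' : connect (link P a b) b a.
  rewrite (@sym_connect_sym _ (link P a b)) // => x y; exact: linkC.
(* only the ends a and b of the path meet z *)
have zS x : x \in a |: (b |: P) -> meets x z -> (x == a) || (x == b).
  by rewrite !inE => /or3P [-> //|->|/Pz /negPf ->//]; rewrite orbT.
have /fE : z |: (a |: (b |: P)) \subset E by rewrite !subUset !sub1set zE aE bE.
case.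
  apply: leq_trans (subset_leq_card (_ : [set a; b] \subset _)).
    by rewrite cards2 nba.
  by rewrite !subUset !sub1set !inE !eqxx !orbT.
move=> f [g [fS gS ngf h]].
have az' := h a; have bz' := h b; have zz' := h z.
rewrite !inE !eqxx ?orbT /= in az' bz' zz'.
case/setU1P: fS => [efz|fS].
  subst f; have /andP [zg ag] : meets z g && meets a g.
    by apply: meets_sub (az' isT nza); rewrite meetsC.
  have /andP [_ bg] : meets z g && meets b g.
    by apply: meets_sub (bz' isT nzb); rewrite meetsC.
  case/setU1P: gS => [gz|gS]; first by rewrite gz eqxx in ngf.
  case/orP: (zS g gS (etrans (meetsC _ _) zg)) => /eqP eg; subst g.
    by rewrite meetsC bg in nab.
  by rewrite ag in nab.
(* neither end of the path can be the leaf f *)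
have hend c d : (c == a) && (d == b) || (c == b) && (d == a) ->
    ~~ meets c d -> f = c -> c != d -> meets c z -> d != c ->
    connect (link P a b) c d -> False.
  move=> ecd ncd efc n1 cz n2 cn; subst c.
  have /andP [_ zg] : meets f g && meets z g.
    by apply: meets_sub cz (zz' isT _); case/orP: ecd => /andP [/eqP -> _]; rewrite eq_sym.
  have gdz : g = d \/ g = z.
    case/setU1P: gS => [->|gS]; first by right.
    have := zS g gS (etrans (meetsC _ _) zg).
    by case/orP: ecd ngf => /andP [/eqP -> /eqP ->] /negPf -> /=;
       rewrite ?orbF => /eqP ->; left.
  have [x [nxf xS fx]] := link_step n1 cn.
  have /andP [_ xg] : meets f g && meets x g.
    by apply: meets_sub fx (h _ _ nxf); rewrite inE xS orbT.
  case: gdz => eg; subst g.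
    have /andP [fd _] : meets f d && meets z d.
      by apply: meets_sub cz (zz' isT _); apply: contraNneq ngf => zf; subst z;
      case/orP: ecd nza nzb => /andP [/eqP -> _]; rewrite eqxx.
    by rewrite fd in ncd.
  have := zS x xS xg; case/orP: ecd nxf => /andP [/eqP e1 /eqP e2];
    rewrite e1 => /negPf ->; rewrite ?orbF /= => /eqP ex;
    by move: ncd; rewrite e2 -ex fx.
have [efa|nfa] := eqVneq f a.
  apply: (hend a b) => //; rewrite ?eqxx // 1?eq_sym //.
have [efb|nfb] := eqVneq f b.
  apply: (hend b a) => //; rewrite ?eqxx ?orbT // 1?eq_sym // meetsC //.
have fP : f \in P by move: fS; rewrite !inE (negPf nfa) (negPf nfb).
(* every neighbour of f in the path is a neighbour of g: reroute through g *)
have gS' y : y \in a |: (b |: P) -> y != f -> meets y f ->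
    meets y g /\ g \in a |: (b |: P :\ f).
  move=> yS nyf yf.
  have /andP [fg yg] : meets f g && meets y g.
    apply: meets_sub (h y _ nyf); first by rewrite meetsC.
    by rewrite inE yS orbT.
  split=> //; case/setU1P: gS => [gz|].
    by move: (Pz f fP); rewrite -gz fg.
  by rewrite !inE ngf.
suff : connect (link (P :\ f) a b) a b.
  move=> c'; move: nab; rewrite (IH (P :\ f)) //.
  - by rewrite -ltnS; apply: leq_trans cP; rewrite (cardsD1 f P) fP.
  - by apply: subset_trans sPE; apply: subsetDl.
  - by move=> x /setD1P [_ /Pz].
have keep y : y \in a |: (b |: P) -> y != f -> y \in a |: (b |: P :\ f).
  by rewrite !inE => + ->.
have [p pp ep] := connectP conn.
(* the statement followed along the path: f is replaced by g *)
suff : if b == f then connect (link (P :\ f) a b) a g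
       else connect (link (P :\ f) a b) a b.
  by rewrite eq_sym (negPf nfb).
rewrite {1 4}ep; elim/last_ind: p pp {ep} => [|p y IHp] /=.
  by rewrite eq_sym (negPf nfa) => _; apply: connect0.
rewrite rcons_path last_rcons => /andP [/IHp].
set x := last a p => hx /and3P [xS yS xy].
have [exf|nxf] := eqVneq x f; have [eyf|nyf] := eqVneq y f.
- by move: hx; rewrite exf eqxx.
- rewrite exf eqxx in hx; rewrite exf in xy.
  have [yg gS''] := gS' y yS nyf (etrans (meetsC _ _) xy).
  apply: connect_trans hx (connect1 _).
  by rewrite /link gS'' keep // meetsC.
- rewrite (negPf nxf) in hx; rewrite eyf in xy.
  have [xg gS''] := gS' x xS nxf xy.
  apply: connect_trans hx (connect1 _).
  by rewrite /link gS'' keep.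
- rewrite (negPf nxf) in hx; apply: connect_trans hx (connect1 _).
  by rewrite /link !keep.
Qed.

Definition clique K := {in K &, forall A B, meets A B}.

Definition simplicial E F :=
  F \in E /\ {in E &, forall A B, meets A F -> meets B F -> meets A B}.

(** Dirac's argument for chordal graphs.  Avoiding a prescribed clique K is
    what makes the induction work.  Choose z adjacent to all of K.  If z meets
    everything, delete z.  Otherwise take a component Y of the sets disjoint
    from z and the family N of all sets meeting a member of Y: the members of
    N outside Y meet z, form a clique by forest_no_hole, and a simplicial
    vertex of N found in Y is simplicial in E. *)
Lemma forest_simplicial E K : forest E -> {in E, forall A, A != set0} ->
  K \subset E -> K != E -> clique K ->
  exists2 F, F \notin K & simplicial E F.
Proof.
move: {2}#|E| (leqnn #|E|) => n.
elim: n E K => [|n IH] E K cE fE E0 sKE nKE cK.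
  move: cE nKE sKE; rewrite leqn0 cards_eq0 => /eqP ->.
  by rewrite subset0 => /negPf ->.
have mm A : A \in E -> meets A A by rewrite /meets setIid => /E0.
have inE' A : A \in K -> A \in E by move/(subsetP sKE).
have [z zE Kz] : exists2 z, z \in E & {in K, forall A, meets A z}.
  have [K0|[z zK]] := set_0Vmem K.
    have [z zE] : exists z, z \in E.
      by apply/set0Pn; apply: contra nKE => /eqP ->; rewrite K0.
    by exists z => // A; rewrite K0 inE.
  by exists z => [|A AK]; [apply: inE'|apply: cK].
have ltE S : S \subset E -> z \notin S -> #|S| <= n.
  move=> sSE zS; rewrite -ltnS; apply: leq_trans cE.
  by rewrite (cardsD1 z E) zE ltnS subset_leq_card // subsetD1 sSE.
have [allz|] := boolP [forall A in E, meets A z]; last first.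
  rewrite negb_forall_in => /exists_inP [y0 y0E y0z].
  pose e : rel {set T} := fun A B =>
    [&& A \in E, B \in E, ~~ meets A z, ~~ meets B z & meets A B].
  pose Y := [set A | connect e y0 A].
  pose N := [set A in E | [exists B in Y, meets A B]].
  have YE A : A \in Y -> A \in E /\ ~~ meets A z.
    rewrite inE => /connectP [p]; elim/last_ind: p => [|p x _] /=.
      by move=> _ ->.
    by rewrite rcons_path last_rcons => /andP [_ /and5P [_ ? _ ? _]] ->.
  have y0Y : y0 \in Y by rewrite inE connect0.
  have YN A : A \in Y -> A \in N.
    move=> AY; have [AE _] := YE A AY; rewrite inE AE /=.
    by apply/exists_inP; exists A => //; apply: mm.
  have NE A : A \in N -> A \in E by rewrite inE => /andP [].
  have NYz A : A \in N -> A \notin Y -> meets A z.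
    rewrite inE => /andP [AE /exists_inP [B BY AB]]; apply: contraNT => Az.
    move: (BY); rewrite !inE => h; apply: connect_trans h (connect1 _).
    by have [BE Bz] := YE B BY; rewrite /e BE AE Bz Az meetsC.
  have sNE : N \subset E by apply/subsetP.
  have [||||F] := IH N (N :\: Y) _ (forest_sub sNE fE) _ (subsetDl _ _).
  - apply: ltE => //.
    rewrite inE zE /=; apply/exists_inP => -[B BY zB].
    by have [_] := YE B BY; rewrite meetsC zB.
  - by move=> A /NE /E0.
  - apply/eqP => /setP /(_ y0); rewrite !inE connect0 /=.
    by move: (YN _ y0Y); rewrite inE => ->.
  (* a pair of disjoint members of N outside Y would close a hole through z *)
  - move=> a b /setDP [aN aY] /setDP [bN bY].
    apply: (@forest_no_hole E Y z) => //; rewrite ?NE ?NYz //.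
    + by apply/subsetP => A /YE [].
    + by move=> A /YE [].
    + have hop c : c \in N -> exists2 B, B \in Y & meets c B.
        by rewrite inE => /andP [_ /exists_inP].
      have [A AY aA] := hop a aN; have [B BY bB] := hop b bN.
      have sub : subrel e (connect e) by move=> x y; apply: connect1.
      have csym : connect_sym e.
        apply: sym_connect_sym => x y; rewrite /e (meetsC y x).
        by apply/and5P/and5P => -[*]; split.
      have AB : connect (link Y a b) A B.
        have : connect e A B.
          by move: AY BY; rewrite !inE csym => h1 h2; apply: connect_trans h1 h2.
        move=> /connectP [p pp ->]; elim: p A AY pp {aA} => [|x p IHp] A AY /=.
          by move=> _; apply: connect0.
        case/andP=> Ax px; have xY : x \in Y.
          by move: AY; rewrite !inE => h; apply: connect_trans h (connect1 Ax).
        apply: connect_trans (IHp x xY px); apply: connect1.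
        have /and5P [_ _ _ _ Ax'] := Ax.
        by rewrite /link 4!in_setU1 AY xY !orbT.
      apply: connect_trans (connect_trans (connect1 _) AB) (connect1 _).
        by rewrite /link !in_setU1 eqxx AY !orbT.
      by rewrite /link !in_setU1 eqxx BY !orbT meetsC.
  rewrite inE negb_and negbK => FNY [FN sF].
  have FY : F \in Y by case/orP: FNY => //; rewrite FN.
  have [FE Fz] := YE F FY.
  exists F; first by apply: contra Fz => /Kz.
  split=> // A B AE BE AF BF; apply: sF => //; rewrite inE ?AE ?BE /=;
    by apply/exists_inP; exists F.
move/forall_inP: allz => allz.
have [EK|nEK] := boolP (E :\ z \subset K).
  have [F FE FK] : exists2 F, F \in E & F \notin K.
    by apply/subsetPn; apply: contra nKE => sEK; rewrite eqEsubset sKE.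
  exists F => //; split=> // A B AE BE _ _.
  have [->|nA] := eqVneq A z; first by rewrite meetsC allz.
  have [->|nB] := eqVneq B z; first by rewrite allz.
  by apply: cK; apply: (subsetP EK); rewrite !inE ?nA ?nB.
have [|||||F FK [FE sF]] := IH (E :\ z) (K :\ z) _ (forest_sub (subsetDl _ _) fE).
- by rewrite ltE ?subsetDl // !inE eqxx.
- by move=> A /setD1P [_ /E0].
- exact: setSD.
- by apply: contra nEK => /eqP <-; apply: subsetDl.
- by move=> A B /setD1P [_ AK] /setD1P [_ BK]; apply: cK.
move: FE; rewrite !inE => /andP [Fz FE].
exists F; first by apply: contra FK => FK; rewrite !inE Fz.
split=> // A B AE BE AF BF.
have [->|nA] := eqVneq A z; first by rewrite meetsC allz.
have [->|nB] := eqVneq B z; first by rewrite allz.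
by apply: sF; rewrite ?inE ?nA ?nB.
Qed.

(** The neighbours of a simplicial vertex F meet pairwise, hence meet pairwise
    inside F, and the Helly property applies. *)
Lemma forest_nest E : forest E -> {in E, forall A, A != set0} -> E != set0 ->
  exists F v, [/\ F \in E, v \in F & {in E, forall A, meets A F -> v \in A}].
Proof.
move=> fE E0 nE.
have [|||F _ [FE sF]] := @forest_simplicial E set0 fE E0; rewrite ?sub0set //.
- by rewrite eq_sym.
- by move=> A B; rewrite inE.
have [||A B|v vF hv] := @forest_helly E [set A in E | meets A F] F fE.
- by apply/subsetP => A; rewrite inE => /andP [].
- exact: E0.
- rewrite !inE => /andP [AE AF] /andP [BE BF]; have AB := sF A B AE BE AF BF.
  have key (X Y W : {set T}) : X :&: Y \subset W -> meets X Y -> X :&: Y :&: W != set0.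
    by move=> /setIidPl ->.
  case/or3P: (forest_triple fE AE BE FE) => /key; first exact.
    by rewrite setIAC; apply.
  by rewrite setIC setIA; apply.
by exists F, v; split=> // A AE AF; apply: hv; rewrite inE AE.
Qed.

(** Select the pair F, v of forest_nest and discard the sets containing v: all
    the remaining ones are disjoint from F, so that F enlarges the matching
    while v enlarges the cover. *)
Lemma forest_konig E : forest E -> {in E, forall A, A != set0} ->
  exists (M : {set {set T}}) (C : {set T}),
    [/\ M \subset E, trivIset M, C \subset cover E,
        {in E, forall A, C :&: A != set0} & #|C| <= #|M|].
Proof.
move: {2}#|E| (leqnn #|E|) => n; elim: n E => [|n IH] E cE fE E0.
  move: cE; rewrite leqn0 cards_eq0 => /eqP ->.
  exists set0, set0; rewrite !sub0set !cards0; split=> //.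
    by apply/trivIsetP => A B; rewrite inE.
  by move=> A; rewrite inE.
have [->|nE] := eqVneq E set0.
  apply: IH => [||A]; rewrite ?cards0 ?inE //.
  by apply: forest_sub fE; rewrite sub0set.
have [F [v [FE vF hv]]] := forest_nest fE E0 nE.
pose E' := [set A in E | v \notin A].
have sE' : E' \subset E by apply/subsetP => A; rewrite inE => /andP [].
have [|||M [C [ME' tM CE' hC leCM]]] := IH E'.
- rewrite -ltnS; apply: leq_trans cE; apply: proper_card; apply/properP; split=> //.
  by exists F; rewrite // inE vF andbF.
- exact: forest_sub fE.
- by move=> A /(subsetP sE') /E0.
exists (F |: M), (v |: C); split.
- by rewrite subUset sub1set FE (subset_trans ME').
- have FM A : A \in M -> [disjoint F & A].
    move=> /(subsetP ME'); rewrite inE => /andP [AE vA].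
    rewrite -setI_eq0 setIC; apply/negPn; apply: contra vA; exact: hv.
  apply/trivIsetP => A B; rewrite !inE => /orP [/eqP->|AM] /orP [/eqP->|BM].
  + by rewrite eqxx.
  + by move=> _; apply: FM.
  + by move=> _; rewrite disjoint_sym; apply: FM.
  + by move/trivIsetP: tM; apply.
- rewrite subUset sub1set (subset_trans CE') ?andbT.
    by apply/bigcupP; exists F.
  by apply/bigcupsP => A /(subsetP sE') AE; apply: bigcup_sup.
- move=> A AE; apply/set0Pn; have [vA|vA] := boolP (v \in A).
    by exists v; rewrite !inE eqxx.
  have /set0Pn [w] : C :&: A != set0 by apply: hC; rewrite inE AE.
  by rewrite inE => /andP [wC wA]; exists w; rewrite !inE wC orbT.
rewrite cardsU1 [#|F |: M|]cardsU1.
have -> : F \notin M by apply/negP => /(subsetP ME'); rewrite inE vF andbF.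
by apply: leq_add leCM; case: (_ \notin _).
Qed.
End Forests.

(** * Unmixed trees are grafted *)

Section UnmixedTrees.
Variables (T : finType) (D : simplicial_complex T).
Implicit Types (S M : {set {set T}}) (A B C F G H K N : {set T}).

Lemma facet_face F : F \in facets D -> F \in faces D.
Proof. by rewrite inE => /maxsetP []. Qed.

Lemma facets_antichain F G : F \in facets D -> G \in facets D ->
  F \subset G -> F = G.
Proof.
rewrite inE => /maxsetP [_ maxF] /facet_face GD sFG.
by rewrite (maxF G).
Qed.

Lemma cover_facets : cover (facets D) = vertices D.
Proof.
apply/setP => v; apply/bigcupP/idP => [[F /facet_face FD vF]|vD].
  exact: subsetP (face_sub_vertices FD) v vF.
have [F mF vF] := @maxset_exists _ (mem (faces D)) _ (vertex_face vD).
by exists F; rewrite ?inE // -sub1set.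
Qed.

Section Generated.
Variables (S : {set {set T}}) (sSD : S \subset facets D) (S0 : S != set0).

Definition gen_faces : {set {set T}} :=
  [set A : {set T} | [exists F in S, A \subset F]].

Fact gen_vertices_neq0 : cover S != set0.
Proof.
have [F FS] := set0Pn _ S0.
have /set0Pn [v vF] := facet_neq0 (subsetP sSD _ FS).
by apply/set0Pn; exists v; apply/bigcupP; exists F.
Qed.

Fact gen_face_sub F : F \in gen_faces -> F \subset cover S.
Proof.
rewrite inE => /exists_inP [G GS sFG].
by apply: subset_trans sFG _; apply: bigcup_sup.
Qed.

Fact gen_face_closed F G : F \in gen_faces -> G \subset F -> G \in gen_faces.
Proof.
rewrite !inE => /exists_inP [H HS sFH] sGF.
by apply/exists_inP; exists H => //; apply: subset_trans sFH.
Qed.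

Fact gen_vertex_face v : v \in cover S -> [set v] \in gen_faces.
Proof.
case/bigcupP => F FS vF; rewrite inE; apply/exists_inP; exists F => //.
by rewrite sub1set.
Qed.

(** The subcollection of D with prescribed facets: leaves of families of facets
    are leaves of complexes. *)
Definition generated_complex :=
  SimplicialComplex gen_vertices_neq0 gen_face_sub gen_face_closed
    gen_vertex_face.

Lemma facets_generated : facets generated_complex = S.
Proof.
apply/setP => F; rewrite inE; apply/maxsetP/idP => /= [[]|FS].
  rewrite inE => /exists_inP [G GS sFG] maxF.
  rewrite -(maxF G) // inE; apply/exists_inP; exists G => //.
split; first by rewrite inE; apply/exists_inP; exists F.
move=> B; rewrite inE => /exists_inP [G GS sBG] sFB.
apply/eqP; rewrite eqEsubset sFB andbT.
by rewrite (facets_antichain (subsetP sSD _ FS) (subsetP sSD _ GS)) ?(subset_trans sFB).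
Qed.

End Generated.

Lemma tree_forest : tree D -> forest (facets D).
Proof.
case=> _ hD S sSD S1.
have S0 : S != set0 by rewrite -card_gt0 ltnW.
have eS := facets_generated sSD S0.
have [||F []] := hD (generated_complex sSD S0); rewrite ?/subcollection eS //.
move=> FS [S1F|[G GS [nGF hG]]]; last by exists F, G.
by rewrite S1F cards1 in S1.
Qed.

Lemma minimal_cover_in N : N \subset vertices D ->
  (forall F, F \in facets D -> N :&: F != set0) ->
  exists2 C, minimal_vertex_cover D C & C \subset N.
Proof.
move=> NV hN; have : vertex_cover D N by rewrite /vertex_cover NV; apply/forall_inP.
by case/minset_exists => C; exists C.
Qed.

Lemma minimal_cover_meets C F : minimal_vertex_cover D C -> F \in facets D ->
  exists2 v, v \in C & v \in F.
Proof.
case/minsetP => /andP [_ /forall_inP hC] _ /hC /set0Pn [v].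
by rewrite inE => /andP []; exists v.
Qed.

(** The complement of G minus v, for a facet G through v, is a cover because
    the facets form an antichain; a minimal cover in it can only meet G at v. *)
Lemma exists_minimal_cover_at v : v \in vertices D ->
  exists2 C, minimal_vertex_cover D C & v \in C.
Proof.
rewrite -cover_facets => /bigcupP [G GD vG].
have [|F FD|C mC sC] := @minimal_cover_in (vertices D :\: (G :\ v)).
- exact: subsetDl.
- have /subsetPn [w wF wG] : ~~ (F \subset G :\ v).
    apply/negP => sF.
    have eFG : F = G by apply: facets_antichain (subset_trans sF (subsetDl _ _)).
    by move/subsetP: sF => /(_ v); rewrite eFG vG !inE eqxx => /(_ isT).
  apply/set0Pn; exists w; rewrite !in_setI in_setD wG wF andbT.
  by rewrite -cover_facets; apply/bigcupP; exists F.
exists C => //; have [w wC wG] := minimal_cover_meets mC GD.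
by move/subsetP: sC => /(_ w wC); rewrite !inE wG andbT => /andP [/negPn /eqP <-].
Qed.

Hypotheses (forestD : forest (facets D)) (unmixedD : unmixed D).

(** Compare the size r of a minimal cover with the r disjoint facets that it
    must meet: it has exactly one vertex in each of them, and no other. *)
Lemma unmixed_matching : exists M, [/\ M \subset facets D, trivIset M,
  cover M = vertices D & forall C F, minimal_vertex_cover D C -> F \in M ->
    {in C :&: F &, forall u w, u = w}].
Proof.
have [M [C0 [MD tM C0V hC0 leC0M]]] :=
  forest_konig forestD (fun F FD => facet_neq0 FD).
rewrite cover_facets in C0V.
have [C1 mC1 sC10] := minimal_cover_in C0V hC0.
have leCM C : minimal_vertex_cover D C -> #|C| <= #|M|.
  move=> mC; rewrite (unmixedD mC mC1); apply: leq_trans leC0M.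
  exact: subset_leq_card.
have hC C : minimal_vertex_cover D C ->
    C \subset cover M /\ forall F, F \in M -> #|C :&: F| = 1.
  move=> mC.
  have ge1 F : F \in M -> 1 <= #|C :&: F| ?= iff (1 == #|C :&: F|).
    move=> FM; apply/leqif_eq; rewrite card_gt0.
    have [v vC vF] := minimal_cover_meets mC (subsetP MD _ FM).
    by apply/set0Pn; exists v; rewrite inE vC.
  have eI : \sum_(F in M) #|C :&: F| = #|C :&: cover M|.
    rewrite -sum1_card (eq_bigl (fun x => (x \in cover M) && (x \in C))).
      rewrite big_trivIset_cond //; apply: eq_bigr => F FM.
      by rewrite -sum1_card; apply: eq_bigl => x; rewrite inE andbC.
    by move=> x; rewrite inE andbC.
  have /leqif_sum [le1 eq1] := ge1.
  have leC : #|C :&: cover M| <= #|C| by apply/subset_leq_card/subsetIl.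
  rewrite sum1_card eI in le1 eq1.
  have e1 : #|C :&: cover M| = #|M|.
    by apply/eqP; rewrite eqn_leq le1 (leq_trans leC) ?leCM.
  split.
    apply/setIidPl/eqP; rewrite eqEcard subsetIl /= e1; exact: leCM.
  by move: eq1; rewrite e1 eqxx => /esym /forall_inP h F /h /eqP.
exists M; split=> //.
- apply/eqP; rewrite eqEsubset; apply/andP; split.
    apply/bigcupsP => F /(subsetP MD) FD; rewrite -cover_facets.
    exact: bigcup_sup.
  apply/subsetP => v /exists_minimal_cover_at [C /hC [sC _]].
  exact: subsetP sC v.
- move=> C F /hC [_ h] /h /eqP /cards1P [x ->] u w.
  by rewrite !inE => /eqP -> /eqP ->.
Qed.

(** Otherwise the complement of (G :|: H) minus u and w is a vertex cover; a
    minimal cover inside it meets G only at u and H only at w, so it contains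
    two vertices of the block F. *)
Lemma unmixed_exchange M F G H u w :
  (forall C F, minimal_vertex_cover D C -> F \in M ->
    {in C :&: F &, forall u w, u = w}) ->
  F \in M -> u \in F -> w \in F -> u != w ->
  G \in facets D -> H \in facets D ->
  u \in G -> w \notin G -> w \in H -> u \notin H ->
  exists2 K, K \in facets D & K \subset (G :|: H) :\: [set u; w].
Proof.
move=> hM FM uF wF nuw GD HD uG wG wH uH.
have [/exists_inP [K KD sK]|no] :=
  boolP [exists K in facets D, K \subset (G :|: H) :\: [set u; w]]; first by exists K.
have [||C mC sC] := @minimal_cover_in (vertices D :\: ((G :|: H) :\: [set u; w])).
- exact: subsetDl.
- move=> K KD; have /subsetPn [x xK xN] : ~~ (K \subset (G :|: H) :\: [set u; w]).
    by apply: contra no => sK; apply/exists_inP; exists K.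
  apply/set0Pn; exists x; rewrite in_setI in_setD xN xK andbT.
  by rewrite -cover_facets; apply/bigcupP; exists K.
have uC : u \in C.
  have [x xC xG] := minimal_cover_meets mC GD.
  move/subsetP: sC => /(_ x xC); rewrite !inE xG /= andbT => /andP [/negPn].
  case/orP=> /eqP ex _; first by rewrite -ex.
  by rewrite -ex xG in wG.
have wC : w \in C.
  have [x xC xH] := minimal_cover_meets mC HD.
  move/subsetP: sC => /(_ x xC); rewrite !inE xH /= orbT andbT => /andP [/negPn].
  case/orP=> /eqP ex _; last by rewrite -ex.
  by rewrite -ex xH in uH.
by have := hM C F mC FM u w; rewrite !inE uC uF wC wF => /(_ isT isT) /eqP; rewrite (negPf nuw).
Qed.

(** Let u and w witness that the traces of G and H on F are incomparable, and
    let K be the facet of unmixed_exchange.  In the family F, G, H, K neither F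
    nor K is a leaf.  If G (or H) is one, its joint must be F, so that K meets
    G (or H) inside F; this leads to K \subset F. *)
Lemma unmixed_chain M F G H : M \subset facets D ->
  (forall C F, minimal_vertex_cover D C -> F \in M ->
    {in C :&: F &, forall u w, u = w}) ->
  F \in M -> G \in facets D -> H \in facets D ->
  (F :&: G \subset H) || (F :&: H \subset G).
Proof.
move=> MD hM FM GD HD; have FD := subsetP MD _ FM.
apply/negPn; rewrite negb_or; apply/negP => /andP [].
have triple A B : A \in facets D -> B \in facets D ->
    ~~ (F :&: A \subset B) -> ~~ (F :&: B \subset A) -> A :&: B \subset F.
  move=> AD BD nAB nBA; move: (forest_triple forestD FD AD BD).
  by rewrite (negPf nAB) (negPf nBA) /=.
move=> nGH nHG.
have /subsetPn [u] := nGH; have /subsetPn [w] := nHG.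
rewrite !inE => /andP [wF wH] wG /andP [uF uG] uH.
have nuw : u != w by apply: contraNneq wG => <-.
have [K KD sK] := unmixed_exchange hM FM uF wF nuw GD HD uG wG wH uH.
have uK : u \notin K by apply/negP => /(subsetP sK); rewrite !inE eqxx.
have wK : w \notin K by apply/negP => /(subsetP sK); rewrite !inE eqxx orbT.
have sKGH : K \subset G :|: H by apply: subset_trans sK (subsetDl _ _).
(* if K meets A inside F, the pair (K, B) is incomparable on F as well, so K
   also meets B inside F, and K is contained in F *)
have stuck A B x : A \in facets D -> B \in facets D -> K \subset A :|: B ->
    x \in F -> x \in B -> x \notin K -> K :&: A \subset F -> False.
  move=> AD BD sAB xF xB xK sKA.
  have nKB : ~~ (F :&: K \subset B).
    have : ~~ (K \subset B).
      apply/negP => /(facets_antichain KD BD) eKB.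
      by rewrite eKB xB in xK.
    case/subsetPn=> y yK yB; apply/subsetPn; exists y => //.
    have yA : y \in A by move/subsetP: sAB => /(_ y yK); rewrite inE (negPf yB) orbF.
    by rewrite inE yK andbT; apply: (subsetP sKA); rewrite inE yK.
  have nBK : ~~ (F :&: B \subset K) by apply/subsetPn; exists x; rewrite // inE xF.
  have sKB := triple K B KD BD nKB nBK.
  have sKF : K \subset F.
    apply/subsetP => y yK; move/subsetP: sAB => /(_ y yK); rewrite inE.
    by case/orP => [yA|yB]; [apply: (subsetP sKA)|apply: (subsetP sKB)]; rewrite inE yK.
  by move: xK; rewrite (facets_antichain KD FD sKF) xF.
have /forestD : [set F; G; H; K] \subset facets D.
  by rewrite !subUset !sub1set FD GD HD KD.
case.
  apply: leq_trans (subset_leq_card (_ : [set G; H] \subset _)).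
    by rewrite cards2; case: eqP => // eGH; rewrite -eGH uG in uH.
  by rewrite !subUset !sub1set !inE !eqxx ?orbT.
move=> X [Y [XS YS nYX hX]].
have memS : (Y == F) || [|| Y == G, Y == H | Y == K] by move: YS; rewrite !inE -!orbA.
have := And4 (hX F) (hX G) (hX H) (hX K); rewrite !inE !eqxx ?orbT /=.
case=> /(_ isT) hF /(_ isT) hG /(_ isT) hH /(_ isT) hK.
have nFG : F != G by apply: contraNneq wG => <-.
have nFH : F != H by apply: contraNneq uH => <-.
have nFK : F != K by apply: contraNneq uK => <-.
move: XS; rewrite !inE -!orbA => /or4P [] /eqP eX; subst X.
- have uY : u \in Y by apply: (subsetP (hG _)); rewrite 1?eq_sym // inE uF.
  have wY : w \in Y by apply: (subsetP (hH _)); rewrite 1?eq_sym // inE wF.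
  case/or4P: memS => /eqP eY; subst Y.
  + by rewrite eqxx in nYX.
  + by rewrite wY in wG.
  + by rewrite uY in uH.
  + by rewrite uY in uK.
- have uY : u \in Y by apply: (subsetP (hF nFG)); rewrite inE uF uG.
  have eY : Y = F.
    case/or4P: memS => /eqP // eY; subst Y; first by rewrite eqxx in nYX.
      by rewrite uY in uH.
    by rewrite uY in uK.
  subst Y; apply: (@stuck G H w) => //; rewrite setIC; apply: hK.
  by apply: contraNneq uK => ->.
- have wY : w \in Y by apply: (subsetP (hF nFH)); rewrite inE wF wH.
  have eY : Y = F.
    case/or4P: memS => /eqP // eY; subst Y; first by rewrite wY in wG.
      by rewrite eqxx in nYX.
    by rewrite wY in wK.
  subst Y; apply: (@stuck H G u) => //; first by rewrite setUC.
  by rewrite setIC; apply: hK; apply: contraNneq wK => ->.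
- have KY : K \subset Y.
    apply/subsetP => y yK; move/subsetP: sKGH => /(_ y yK); rewrite inE.
    case/orP => [yG|yH].
      by apply: (subsetP (hG _)); rewrite ?inE ?yK //; apply: contraNneq uK => <-.
    by apply: (subsetP (hH _)); rewrite ?inE ?yK //; apply: contraNneq wK => <-.
  have YD : Y \in facets D by case/or4P: memS => /eqP ->.
  by rewrite (facets_antichain KD YD KY) eqxx in nYX.
Qed.

End UnmixedTrees.

(** A predicate that is inherited by earlier entries selects an initial
    segment. *)
Lemma filter_take (T : eqType) (p : pred T) (s : seq T) :
  pairwise (fun x y => p y ==> p x) s -> filter p s = take (count p s) s.
Proof.
elim: s => //= x s IH /andP [/allP hx /IH ->].
have [//|px] := boolP (p x).
rewrite (_ : count p s = 0) ?take0 //.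
apply/eqP; rewrite -leqn0 leqNgt -has_count; apply/hasPn => y /hx.
by rewrite (negPf px) implybF.
Qed.

Section Grafting.
Variables (T : finType) (D : simplicial_complex T).
Implicit Types (M : {set {set T}}) (F G : {set T}).

(** rt maps each vertex to the root of its block and fixes the elements outside
    the vertex set; Rt is the set of roots; fac i lists the block of the root i
    (its values past the end of the block only have to stay in the block).  The
    last field says that a facet meets every block in an initial segment of
    that list. *)
Record grafting (rt : T -> T) (Rt : {set T}) (fac : T -> nat -> T) : Prop := {
  graft_rt : forall j, rt j != j -> rt j \in Rt;
  graft_root : forall i, i \in Rt -> rt i = i;
  graft_fac : forall i l, i \in Rt -> rt (fac i l) = i;
  graft_block : forall i, i \in Rt ->
    exists2 F, F \in facets D & {in F, forall j, rt j = i};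
  graft_facet : forall G, G \in facets D ->
    {in G, forall j, rt j \in Rt} /\
    forall i, i \in Rt -> perm_eq (enum [set j in G | rt j == i])
      [seq fac i l | l <- iota 0 #|[set j in G | rt j == i]|]
}.

(** Listing a block by decreasing number of facets through its vertices makes
    all traces initial segments, because they form a chain. *)
Theorem unmixed_tree_grafting : tree D -> unmixed D ->
  exists rt Rt fac, grafting rt Rt fac.
Proof.
move=> /tree_forest fD uD.
have [M [MD tM cM hM]] := unmixed_matching fD uD.
pose deg x := #|[set G in facets D | x \in G]|.
pose geq_deg x y := deg y <= deg x.
pose ord F := sort geq_deg (enum F).
have memo F x : (x \in ord F) = (x \in F) by rewrite mem_sort mem_enum.
have uo F : uniq (ord F) by rewrite sort_uniq enum_uniq.
have pw F G : F \in M -> G \in facets D ->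
    pairwise (fun x y => (y \in G) ==> (x \in G)) (ord F).
  move=> FM GD; have : pairwise geq_deg (ord F).
    have tr : transitive geq_deg by move=> y x z h1 h2; apply: leq_trans h2 h1.
    rewrite -sorted_pairwise // sort_sorted // => x y; exact: leq_total.
  rewrite -(_ : pairwise (fun x y => (x \in F) && (y \in F) && geq_deg x y) (ord F)
               = pairwise geq_deg (ord F)); last first.
    have : all (mem F) (ord F) by apply/allP => x; rewrite memo.
    elim: (ord F) => //= x s IH /andP [xF sF]; rewrite IH //; congr (_ && _).
    by apply: eq_in_all => y /(allP sF) yF; rewrite (xF : x \in F) (yF : y \in F).
  apply: sub_pairwise => x y /andP [/andP [xF yF]]; apply: contraTT.
  rewrite negb_imply -ltnNge => /andP [yG xG].
  apply: proper_card; apply/properP; split.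
    apply/subsetP => H /setIdP [HD xH]; rewrite in_set HD /=.
    case/orP: (unmixed_chain fD MD hM FM GD HD) => /subsetP h.
      by have := h y; rewrite !inE yF yG => /(_ isT).
    by move: (h x); rewrite inE xF xH (negPf xG) => /(_ isT).
  by exists G; rewrite in_set; [rewrite GD|rewrite (negPf xG) andbF].
pose rt j := if j \in vertices D then head j (ord (pblock M j)) else j.
have bV j : j \in vertices D -> pblock M j \in M /\ j \in pblock M j.
  by move=> jV; rewrite pblock_mem ?mem_pblock cM.
have rtV j : j \in vertices D -> rt j \in pblock M j /\ rt j \in vertices D.
  move=> jV; have [bM jb] := bV j jV.
  have h : rt j \in pblock M j.
    rewrite /rt jV -memo; move: jb; rewrite -memo.
    by case: (ord _) => //= x s _; rewrite inE eqxx.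
  by split=> //; rewrite -cM; apply/bigcupP; exists (pblock M j).
have same j x : j \in vertices D -> x \in pblock M j -> rt x = rt j.
  move=> jV xb; have [bM jb] := bV j jV.
  have xV : x \in vertices D by rewrite -cM; apply/bigcupP; exists (pblock M j).
  rewrite /rt xV jV (def_pblock tM bM xb).
  by move: jb; rewrite -memo; case: (ord _).
have rtrt j : rt (rt j) = rt j.
  have [jV|/negPf njV] := boolP (j \in vertices D); last by rewrite /rt njV njV.
  by apply: same => //; case: (rtV j jV).
pose Rt := [set j in vertices D | rt j == j].
have blockP i x : i \in Rt -> (rt x == i) = (x \in pblock M i).
  rewrite inE => /andP [iV /eqP ei]; apply/eqP/idP => [ex|/(same _ _ iV) ->//].
  have [xV|/negPf nxV] := boolP (x \in vertices D).
    have [bM xb] := bV x xV; have [rb _] := rtV x xV.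
    by rewrite -ex (def_pblock tM bM rb).
  by move: ex; rewrite /rt nxV => ex; rewrite ex iV in nxV.
exists rt, Rt, (fun i l => nth i (ord (pblock M i)) l).
have RtV i : i \in Rt -> i \in vertices D by rewrite inE => /andP [].
split.
- move=> j; rewrite inE rtrt eqxx andbT.
  have [jV _|/negPf njV] := boolP (j \in vertices D); first by case: (rtV j jV).
  by rewrite /rt njV eqxx.
- by move=> i; rewrite inE => /andP [_ /eqP].
- move=> i l iR; apply/eqP; rewrite blockP //.
  have [_ ib] := bV i (RtV i iR).
  have [ll|ll] := ltnP l (size (ord (pblock M i))).
    by rewrite -memo mem_nth.
  by rewrite nth_default.
- move=> i iR; have [bM _] := bV i (RtV i iR).
  by exists (pblock M i); [apply: (subsetP MD)|move=> j jb; apply/eqP; rewrite blockP].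
move=> G GD; split.
  move=> j jG; have jV : j \in vertices D.
    by rewrite -cover_facets; apply/bigcupP; exists G.
  by rewrite inE rtrt eqxx andbT; case: (rtV j jV).
move=> i iR; have [bM _] := bV i (RtV i iR).
set s := ord (pblock M i); set k := #|_|.
have e : enum [set j in G | rt j == i] =i filter (mem G) s.
  by move=> x; rewrite mem_enum mem_filter memo inE blockP.
have pe : perm_eq (enum [set j in G | rt j == i]) (filter (mem G) s).
  by apply: uniq_perm; rewrite ?enum_uniq ?filter_uniq ?uo.
have ek : k = count (mem G) s by rewrite -size_filter -(perm_size pe) -cardE.
apply: perm_trans pe _; rewrite filter_take ?pw // -ek.
by rewrite map_nth_iota0 // ek count_size.
Qed.

End Grafting.

Import GRing.Theory.
Local Open Scope ring_scope.

(** * Triangular bases of a polynomial ring *)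

(** A family b indexed by the monomials, where b m differs from 'X_[m] by
    monomials of smaller weight, is a k-basis of the polynomial ring.  No
    monomial order is needed: any weight in nat gives enough control. *)
Section TriangularBasis.
Variables (k : fieldType) (n : nat) (w : 'X_{1..n} -> nat).
Implicit Types (f g : {mpoly k[n]}) (b : 'X_{1..n} -> {mpoly k[n]}).

Definition wlt N f := all (fun m => w m < N)%N (msupp f).

Lemma wltP N f : reflect (forall m, f@_m != 0 -> (w m < N)%N) (wlt N f).
Proof.
apply: (iffP allP) => h m; first by rewrite -mcoeff_msupp; apply: h.
by rewrite mcoeff_msupp; apply: h.
Qed.

Lemma wlt0 N : wlt N 0.
Proof. by apply/wltP => m; rewrite mcoeff0 eqxx. Qed.

Lemma wltD N f g : wlt N f -> wlt N g -> wlt N (f + g).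
Proof.
move=> /wltP hf /wltP hg; apply/wltP => m; rewrite mcoeffD.
by have [->|/hf //] := eqVneq f@_m 0; rewrite add0r; apply: hg.
Qed.

Lemma wltZ N c f : wlt N f -> wlt N (c *: f).
Proof.
move=> /wltP hf; apply/wltP => m; rewrite mcoeffZ.
by have [->|/hf //] := eqVneq f@_m 0; rewrite mulr0 eqxx.
Qed.

Lemma wltN N f : wlt N f -> wlt N (- f).
Proof. by rewrite -scaleN1r; apply: wltZ. Qed.

Lemma wlt_sum N (I : eqType) (r : seq I) (F : I -> {mpoly k[n]}) :
  (forall i, i \in r -> wlt N (F i)) -> wlt N (\sum_(i <- r) F i).
Proof.
move=> hF; rewrite big_seq; elim/big_rec: _ => [|i x ir]; first exact: wlt0.
by apply: wltD; apply: hF.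
Qed.

Lemma wlt_le N N' f : (N <= N')%N -> wlt N f -> wlt N' f.
Proof. by move=> le /wltP h; apply/wltP => m /h /leq_trans; apply. Qed.

(** The k-linear map sending each monomial 'X_[m] to b m. *)
Definition expand b f := \sum_(m <- msupp f) f@_m *: b m.

Lemma expandwE b f i : (msize f <= i)%N ->
  expand b f = \sum_(m : 'X_{1..n < i}) f@_m *: b m.
Proof.
move=> le_i; rewrite /expand; set I : subFinType _ := 'X_{1..n < i}.
rewrite (big_mksub I) ?msupp_uniq //=; first last.
  by move=> x /msize_mdeg_lt /leq_trans; apply.
by rewrite big_rmcond //= => j /memN_msupp_eq0 ->; rewrite scale0r.
Qed.

Lemma expandD b f g : expand b (f + g) = expand b f + expand b g.
Proof.
pose i := maxn (msize (f + g)) (maxn (msize f) (msize g)).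
rewrite !(@expandwE _ _ i) ?leq_max ?leqnn ?orbT // -big_split /=.
by apply: eq_bigr => m _; rewrite mcoeffD scalerDl.
Qed.

Lemma expandZ b c f : expand b (c *: f) = c *: expand b f.
Proof.
pose i := maxn (msize (c *: f)) (msize f).
rewrite !(@expandwE _ _ i) ?leq_max ?leqnn ?orbT // scaler_sumr.
by apply: eq_bigr => m _; rewrite mcoeffZ scalerA.
Qed.

Lemma expandB b f g : expand b (f - g) = expand b f - expand b g.
Proof. by rewrite expandD -scaleN1r expandZ scaleN1r. Qed.

Lemma expand0 b : expand b 0 = 0.
Proof. by rewrite /expand msupp0 big_nil. Qed.

Lemma expandXm b m : expand b 'X_[m] = b m.
Proof. by rewrite /expand msuppX big_seq1 mcoeffX eqxx scale1r. Qed.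

Definition triangular b := forall m, wlt (w m) (b m - 'X_[m]).

(** The engine of both injectivity and surjectivity of expand: it is the
    identity modulo terms of smaller weight. *)
Lemma wlt_expand b N f : triangular b -> wlt N.+1 f -> wlt N (f - expand b f).
Proof.
move=> tb /wltP hf; rewrite {1}[f]mpolyE /expand -sumrB.
apply: wlt_sum => m; rewrite mcoeff_msupp => /hf; rewrite ltnS => le_m.
rewrite -scalerBr -opprB; apply/wltZ/wltN; exact: wlt_le (tb m).
Qed.

Lemma wlt_exists f : exists N, wlt N f.
Proof.
exists (\max_(m <- msupp f) (w m).+1)%N; apply/allP => m mf.
by rewrite (big_rem m) //= leq_max leqnn.
Qed.

Lemma wlt0_eq0 f : wlt 0 f -> f = 0.
Proof.
by move=> /wltP h; apply/mpolyP => m; rewrite mcoeff0; apply/eqP/negPn/negP => /h.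
Qed.

Lemma expand_inj b f : triangular b -> expand b f = 0 -> f = 0.
Proof.
move=> tb f0; have [N] := wlt_exists f; elim: N => [|N IH]; first exact: wlt0_eq0.
by move=> /(wlt_expand tb); rewrite f0 subr0.
Qed.

Lemma expand_surj b g : triangular b -> exists f, expand b f = g.
Proof.
move=> tb; have [N] := wlt_exists g; elim: N g => [|N IH] g.
  by move/wlt0_eq0 ->; exists 0; rewrite expand0.
move=> /(wlt_expand tb) /IH [f ef]; exists (g + f).
by rewrite expandD ef addrC subrK.
Qed.

Hypothesis wD : forall m m', w (m + m')%MM = (w m + w m')%N.

Lemma wltM N N' f g : wlt N.+1 f -> wlt N' g -> wlt (N + N') (f * g).
Proof.
move=> /wltP hf /wltP hg; apply/allP => m /msuppM_le /allpairsP [[a c] /= [af cg ->]].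
rewrite wD -addnS leq_add //; [rewrite -ltnS; apply: hf|apply: hg];
  by rewrite -mcoeff_msupp.
Qed.

Lemma wltX m : wlt (w m).+1 'X_[m].
Proof. by rewrite /wlt msuppX /= ltnSn. Qed.

(** Multiplicative form of triangularity: by leadsM it passes from factors to
    products when the weight is additive. *)
Definition leads m f := wlt (w m) (f - 'X_[m]).

Lemma leads1 : leads 0%MM 1.
Proof. by rewrite /leads mpolyX0 subrr wlt0. Qed.

Lemma leadsM m m' f g : leads m f -> leads m' g -> leads (m + m')%MM (f * g).
Proof.
move=> hf hg; rewrite /leads wD mpolyXD.
have -> : f * g - 'X_[m] * 'X_[m'] = f * (g - 'X_[m']) + 'X_[m'] * (f - 'X_[m]).
  by rewrite !mulrBr addrA (mulrC _ f) subrK (mulrC 'X_[m']).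
apply: wltD.
  apply: wltM hg; rewrite -[f](subrK 'X_[m]); apply: wltD (wltX _).
  exact: wlt_le hf.
by rewrite addnC; apply: wltM hf; apply: wltX.
Qed.

Lemma leads_prod (I : finType) (P : pred I) (M : I -> 'X_{1..n}) F :
  (forall i, P i -> leads (M i) (F i)) ->
  leads (\sum_(i | P i) M i)%MM (\prod_(i | P i) F i).
Proof.
move=> h; elim/big_rec2: _ => [|i f m Pi]; first exact: leads1.
exact: leadsM (h i Pi).
Qed.

Lemma leadsX m f e : leads m f -> leads (m *+ e)%MM (f ^+ e).
Proof.
move=> hf; elim: e => [|e IH]; first by rewrite mulm0n expr0; apply: leads1.
by rewrite mulmS exprS; apply: leadsM.
Qed.

End TriangularBasis.

(** * Ideals generated by a sequence *)

Section IdealSpan.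
Variable A : comNzRingType.
Implicit Types (J : {pred A}) (s : seq A) (x y : A).

Lemma ideal_spanP s x : reflect (exists c : nat -> A, x = \sum_(i < size s) c i * s`_i)
  (x \in ideal_span s).
Proof. exact: asboolP. Qed.

Lemma ideal_span0 s : 0 \in ideal_span s.
Proof.
by apply/ideal_spanP; exists (fun=> 0); rewrite big1 // => i _; rewrite mul0r.
Qed.

Lemma ideal_spanD s x y :
  x \in ideal_span s -> y \in ideal_span s -> x + y \in ideal_span s.
Proof.
move=> /ideal_spanP [c ->] /ideal_spanP [d ->]; apply/ideal_spanP.
exists (fun i => c i + d i); rewrite -big_split /=.
by apply: eq_bigr => i _; rewrite mulrDl.
Qed.

Lemma ideal_spanM s a x : x \in ideal_span s -> a * x \in ideal_span s.
Proof.
move=> /ideal_spanP [c ->]; apply/ideal_spanP.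
by exists (fun i => a * c i); rewrite mulr_sumr; apply: eq_bigr => i _; rewrite mulrA.
Qed.

Lemma mem_ideal_span s x : x \in s -> x \in ideal_span s.
Proof.
move=> xs; apply/ideal_spanP; exists (fun i => (i == index x s)%:R).
rewrite (bigD1 (Ordinal (etrans (index_mem x s) xs))) //= eqxx mul1r nth_index //.
by rewrite big1 ?addr0 // => i; rewrite -val_eqE /= => /negPf ->; rewrite mul0r.
Qed.

Lemma ideal_span_ind (P : A -> Prop) s :
  P 0 -> (forall x y, P x -> P y -> P (x + y)) ->
  (forall a x, x \in s -> P (a * x)) ->
  forall x, x \in ideal_span s -> P x.
Proof.
move=> P0 PD PM x /ideal_spanP [c ->]; apply: big_ind => // i _.
by apply: PM; apply: mem_nth.
Qed.

Lemma ideal_span_sum s (I : Type) (r : seq I) (Q : pred I) F :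
  (forall i, Q i -> F i \in ideal_span s) ->
  \sum_(i <- r | Q i) F i \in ideal_span s.
Proof.
move=> h; elim/big_ind: _ => //; first exact: ideal_span0.
by move=> *; apply: ideal_spanD.
Qed.

(** Unlike idealr_closed, the whole ring is allowed. *)
Definition weak_ideal J :=
  0 \in J /\ forall a, {in J &, forall u v, a * u + v \in J}.

Lemma weak_ideal_absorb J a x : weak_ideal J -> x \in J -> a * x \in J.
Proof. by case=> J0 hJ xJ; rewrite -[a * x]addr0 hJ. Qed.

Lemma weak_ideal_add J x y : weak_ideal J -> x \in J -> y \in J -> x + y \in J.
Proof. by case=> J0 hJ xJ yJ; rewrite -[x]mul1r hJ. Qed.

Lemma weak_ideal_span s : weak_ideal (ideal_span s).
Proof.
split; first exact: ideal_span0.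
by move=> a u v us vs; rewrite ideal_spanD // ideal_spanM.
Qed.

Lemma ideal_weak J : idealr_closed J -> weak_ideal J.
Proof. by case. Qed.

End IdealSpan.

(** * The regular sequence of a grafting *)

Section Grafted.
Variables (k : fieldType) (n : nat).
Variables (rt : 'I_n -> 'I_n) (Rt : {set 'I_n}) (fac : 'I_n -> nat -> 'I_n).
Hypothesis rt_root : forall j, rt j != j -> rt j \in Rt.
Hypothesis root_rt : forall i, i \in Rt -> rt i = i.
Hypothesis rt_fac : forall i l, i \in Rt -> rt (fac i l) = i.
Variable q : 'I_n -> {poly k}.
Hypothesis q_monic : forall j, j \notin Rt -> q j \is monic.
Hypothesis q_size : forall j, j \notin Rt -> (1 < size (q j))%N.

Notation R := {mpoly k[n]}.
Implicit Types (f g h x y : R) (o : 'I_n -> nat) (m a : 'X_{1..n}).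

(** The new coordinates: v_i itself for a root v_i, the difference v_i - x_j
    for the other vertices of its block, and x_j off the vertex set. *)
Definition theta j : R := if rt j == j then 'X_j else 'X_(rt j) - 'X_j.

(** The change of coordinates; since v_i - (v_i - x_j) = x_j, it is an
    involution. *)
Definition straighten f : R := f \mPo [tuple theta j | j < n].
Local Notation sigma := straighten.

HB.instance Definition _ := GRing.LRMorphism.copy straighten
  (comp_mpoly [tuple theta j | j < n]).

Lemma straightenX j : sigma 'X_j = theta j.
Proof. by rewrite /straighten comp_mpolyXU -tnth_nth tnth_mktuple. Qed.

Lemma straighten_theta j : sigma (theta j) = 'X_j.
Proof.
rewrite {1}/theta; case: ifP => [e|/negbT e].
  by rewrite straightenX /theta e.
have rr := root_rt (rt_root e).
by rewrite raddfB /= !straightenX /theta rr eqxx (negPf e) opprB addrC subrK.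
Qed.

Lemma straightenK : cancel straighten straighten.
Proof.
elim/mpolyind => [|c m p _ _ IH]; first by rewrite !raddf0.
rewrite !linearP /= IH mpolyXE_id; congr (_ *: _ + _).
rewrite !rmorph_prod /=; apply: eq_bigr => j _.
by rewrite !rmorphXn /= straightenX straighten_theta.
Qed.

(** Roots weigh more than the other variables, so that after straightening the
    Newton factor v_i - theta_j has v_i as its term of largest weight. *)
Definition root_weight m := (\sum_j (if j \in Rt then 2 else 1) * m j)%N.
Local Notation w := root_weight.

Lemma root_weightD m m' : w (m + m')%MM = (w m + w m')%N.
Proof.
rewrite /w -big_split /=; apply: eq_bigr => j _.
by rewrite mnmDE mulnDr.
Qed.

Lemma root_weightUn j e :
  w (U_(j) *+ e)%MM = ((if j \in Rt then 2 else 1) * e)%N.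
Proof.
rewrite /w (bigD1 j) //= mulmnE mnm1E eqxx mul1n big1 ?addn0 // => i ij.
by rewrite mulmnE mnm1E eq_sym (negPf ij) mul0n muln0.
Qed.

Definition qdeg j := (size (q j)).-1.

Definition qval j : R := (map_poly (mpolyC n (R := k)) (q j)).[theta j].

(** For a root j, the Newton product of length m j whose factors start at
    position o j of the block; for the others, an element of a k-basis of
    k[theta_j] adapted to multiplication by q_j(theta_j). *)
Definition base_factor o m j : R :=
  if j \in Rt then \prod_(l < m j) 'X_(fac j (o j + l))
  else qval j ^+ (m j %/ qdeg j) * theta j ^+ (m j %% qdeg j).

Definition base o m : R := \prod_j base_factor o m j.

Lemma leads_root i l : i \in Rt -> leads w U_(i)%MM (sigma 'X_(fac i l)).
Proof.
move=> iR; have e := rt_fac l iR; rewrite straightenX /theta /leads e.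
have [ei|nc] := eqVneq i (fac i l); first by rewrite -ei subrr wlt0.
rewrite addrAC subrr add0r; apply: wltN; rewrite /wlt msuppX /= andbT.
have nR : fac i l \notin Rt.
  by apply: contra nc => /root_rt; rewrite e => {1}->.
by rewrite -[U_(i)%MM]mulm1n -[U_(fac i l)%MM]mulm1n !root_weightUn iR (negPf nR).
Qed.

Lemma leads_qval j : j \notin Rt -> leads w (U_(j) *+ qdeg j)%MM (sigma (qval j)).
Proof.
move=> jR; rewrite /qval -horner_map /= straighten_theta -map_poly_comp /=.
rewrite (eq_map_poly (g := mpolyC n (R := k))); last first.
  by move=> c /=; rewrite -[c%:MP]alg_mpolyC linearZ rmorph1.
have sz : size (q j) = (qdeg j).+1 by rewrite prednK // (ltn_trans _ (q_size jR)).
rewrite horner_coef size_map_poly sz big_ord_recr /= /leads mpolyXn.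
have -> : (map_poly (mpolyC n (R := k)) (q j))`_(qdeg j) = 1.
  have /monicP := q_monic jR; rewrite lead_coefE -/(qdeg j) coef_map /= => ->.
  exact: mpolyC1.
rewrite mul1r addrK; apply: wlt_sum => i _.
rewrite coef_map /= mul_mpolyC mpolyXn; apply: wltZ.
by rewrite /wlt msuppX /= andbT !root_weightUn ltn_mul2l ltn_ord; case: ifP.
Qed.

Lemma base_triangular o : triangular w (fun m => sigma (base o m)).
Proof.
move=> m; rewrite /base rmorph_prod /=.
rewrite {1 3}[m](multinomUE_id m); apply: leads_prod => [|j _]; first exact: root_weightD.
rewrite /base_factor; have [jR|jR] := ifP.
  rewrite rmorph_prod /=.
  have -> : (U_(j) *+ m j)%MM = (\sum_(l < m j) U_(j))%MM.
    by elim: (m j) => [|e IH]; rewrite ?mulm0n ?big_ord0 // big_ord_recr /= mulmSr IH.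
  by apply: leads_prod => [|l _]; [apply: root_weightD|apply: leads_root].
have jR' := negbT jR.
rewrite rmorphM !rmorphXn /= straighten_theta.
rewrite {1}(divn_eq (m j) (qdeg j)).
have -> : (U_(j) *+ (m j %/ qdeg j * qdeg j + m j %% qdeg j))%MM =
    (U_(j) *+ qdeg j *+ (m j %/ qdeg j) + U_(j) *+ (m j %% qdeg j))%MM.
  by apply/mnmP => i; rewrite mnmDE !mulmnE mulnDr -mulnA (mulnC (qdeg j)).
apply: leadsM; [exact: root_weightD| |].
  by apply: leadsX; [apply: root_weightD|apply: leads_qval].
by rewrite mpolyXn /leads subrr wlt0.
Qed.

Lemma straighten_expand b f :
  sigma (expand b f) = expand (fun m => sigma (b m)) f.
Proof.
by rewrite /expand raddf_sum /=; apply: eq_bigr => m _; rewrite linearZ.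
Qed.

Lemma base_inj o f : expand (base o) f = 0 -> f = 0.
Proof.
move=> f0; apply: (expand_inj (base_triangular o)).
by rewrite -straighten_expand f0 raddf0.
Qed.

Lemma base_surj o g : exists f, expand (base o) f = g.
Proof.
have [f ef] := expand_surj (sigma g) (base_triangular o).
by exists f; apply: (can_inj straightenK); rewrite straighten_expand.
Qed.

(** Multiplication by z becomes a translation of exponents. *)
Lemma expand_shift (b b' : 'X_{1..n} -> R) a z :
  (forall m, b' (m + a)%MM = z * b m) ->
  forall f, expand b' (f * 'X_[a]) = z * expand b f.
Proof.
move=> h; elim/mpolyind => [|c m p _ _ IH]; first by rewrite mul0r !expand0 mulr0.
rewrite mulrDl !expandD IH -scalerAl !expandZ -mpolyXD !expandXm h.
by rewrite mulrDr scalerAr.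
Qed.

Definition newton (g : 'I_n -> nat) : R :=
  \prod_(i in Rt) \prod_(l < g i) 'X_(fac i l).

(** The exponent of a Newton product, as a monomial in the roots. *)
Definition root_part (g : 'I_n -> nat) : 'X_{1..n} :=
  [multinom (if i \in Rt then g i else 0)%N | i < n].

(** This is why the offsets o are there: multiplying by the Newton product of
    exponent g carries the basis with offset g into the one with offset 0. *)
Lemma base_newton (g : 'I_n -> nat) m :
  base (fun=> 0%N) (m + root_part g)%MM = newton g * base g m.
Proof.
rewrite /base /newton [X in _ = X * _]big_mkcond -big_split /=; apply: eq_bigr => j _.
rewrite /base_factor mnmDE [root_part g j]mnmE; case: ifP => jR; rewrite jR.
  by rewrite addnC big_split_ord.
by rewrite mul1r addn0.
Qed.

Lemma base_qval o j m : j \notin Rt ->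
  base o (m + U_(j) *+ qdeg j)%MM = qval j * base o m.
Proof.
move=> jR; rewrite /base (bigD1 j) //= [in RHS](bigD1 j) //= mulrA; congr (_ * _).
  rewrite /base_factor (negPf jR) mnmDE mulmnE mnm1E eqxx mul1n.
  have D0 : (0 < qdeg j)%N by rewrite -ltnS prednK ?q_size // (ltn_trans _ (q_size jR)).
  by rewrite modnDr divnDr ?dvdnn // divnn D0 addn1 exprS mulrA.
apply: eq_bigr => i ij; rewrite /base_factor mnmDE mulmnE mnm1E eq_sym (negPf ij).
by rewrite mul0n addn0.
Qed.

Variable gens : seq ('I_n -> nat).
Implicit Types ts : seq 'I_n.

(** The exponents whose basis elements span the ideal generated by the Newton
    products of gens and the q_j(theta_j), j in ts. *)
Definition in_span ts m :=
  has (fun g : 'I_n -> nat => [forall i in Rt, g i <= m i]%N) gens ||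
  has (fun j => qdeg j <= m j)%N ts.

Definition qideal ts : seq R := map newton gens ++ map qval ts.

Lemma base_in_span ts m : {in ts, forall j, j \notin Rt} -> in_span ts m ->
  base (fun=> 0%N) m \in ideal_span (qideal ts).
Proof.
move=> tsR /orP [] /hasP.
  case=> g gG /forall_inP le.
  have <- : ((m - root_part g) + root_part g)%MM = m.
    by rewrite submK //; apply/mnm_lepP => i; rewrite mnmE; case: ifP => // iR; apply: le.
  rewrite base_newton mulrC; apply: ideal_spanM.
  by apply: mem_ideal_span; rewrite mem_cat map_f.
case=> j jts le.
have <- : ((m - U_(j) *+ qdeg j) + U_(j) *+ qdeg j)%MM = m.
  rewrite submK //; apply/mnm_lepP => i; rewrite mulmnE mnm1E.
  by case: eqP => [<-|_]; rewrite ?mul1n ?mul0n.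
rewrite base_qval ?tsR // mulrC; apply: ideal_spanM.
by apply: mem_ideal_span; rewrite mem_cat map_f ?orbT.
Qed.

(** In the basis with offset 0 the ideal is spanned by basis elements.  A
    multiple of a generator is expanded first in the basis whose offset is the
    exponent of that generator. *)
Lemma qidealP ts x : {in ts, forall j, j \notin Rt} ->
  x \in ideal_span (qideal ts) <->
  exists2 f, expand (base (fun=> 0%N)) f = x & forall m, f@_m != 0 -> in_span ts m.
Proof.
move=> tsR; split.
  pose P x := exists2 f, expand (base (fun=> 0%N)) f = x &
    forall m, f@_m != 0 -> in_span ts m.
  apply: (@ideal_span_ind _ P) => [|y z [f ef hf] [g eg hg]|a z].
  - by exists 0; rewrite ?expand0 // => m; rewrite mcoeff0 eqxx.
  - exists (f + g); first by rewrite expandD ef eg.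
    by move=> m; rewrite mcoeffD; have [->|/hf //] := eqVneq f@_m 0; rewrite add0r => /hg.
  - have shift f c m : (f * 'X_[c])@_m != 0 -> exists a', m = (a' + c)%MM.
      rewrite -mcoeff_msupp => /msuppM_le /allpairsP [[a1 a2] /= [_]].
      by rewrite msuppX inE => /eqP -> ->; exists a1.
    rewrite mem_cat => /orP [/mapP [g gG ->]|/mapP [j jts ->]].
      have [f <-] := base_surj g a; exists (f * 'X_[root_part g]).
        by rewrite (expand_shift (base_newton g)) mulrC.
      move=> m /shift [a' ->]; apply/orP; left; apply/hasP; exists g => //.
      by apply/forall_inP => i iR; rewrite mnmDE [root_part g i]mnmE iR leq_addl.
    have [f <-] := base_surj (fun=> 0%N) a; exists (f * 'X_[U_(j) *+ qdeg j]).
      by rewrite (expand_shift (fun m => base_qval (fun=> 0%N) m (tsR j jts))) mulrC.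
    move=> m /shift [a' ->]; apply/orP; right; apply/hasP; exists j => //.
    by rewrite mnmDE mulmnE mnm1E eqxx mul1n leq_addl.
case=> f <- hf; rewrite /expand big_seq; apply: ideal_span_sum => m.
rewrite mcoeff_msupp -mul_mpolyC => /hf hm.
by apply: ideal_spanM; apply: base_in_span.
Qed.

(** Multiplication by q_j(theta_j) translates the exponent at j, and membership
    in in_span ts does not depend on that exponent. *)
Theorem qval_regular ts j y : {in ts, forall j, j \notin Rt} ->
  j \notin Rt -> j \notin ts ->
  qval j * y \in ideal_span (qideal ts) -> y \in ideal_span (qideal ts).
Proof.
move=> tsR jR jts /(qidealP _ tsR) [h eh hh]; apply/(qidealP _ tsR).
have [f ef] := base_surj (fun=> 0%N) y; exists f => // m fm.
have e : h = f * 'X_[U_(j) *+ qdeg j].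
  apply/eqP; rewrite -subr_eq0; apply/eqP; apply: (@base_inj (fun=> 0%N)).
  by rewrite expandB eh -ef (expand_shift (fun m => base_qval (fun=> 0%N) m jR)) subrr.
have /orP [/hasP [g gG /forall_inP le]|/hasP [i its le]] :
    in_span ts (m + U_(j) *+ qdeg j)%MM by apply: hh; rewrite e addmC mcoeffMX.
  apply/orP; left; apply/hasP; exists g => //; apply/forall_inP => i iR.
  have := le i iR; rewrite mnmDE mulmnE mnm1E.
  have -> : (j == i) = false by apply: contraNF jR => /eqP ->.
  by rewrite mul0n addn0.
apply/orP; right; apply/hasP; exists i => //; move: le.
rewrite mnmDE mulmnE mnm1E; have -> : (j == i) = false.
  by apply: contraNF jts => /eqP ->.
by rewrite mul0n addn0.
Qed.

End Grafted.

(** * Hilbert's basis theorem *)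

(** The evaluation morphism p |-> p(x) from {poly B} to C. *)
Definition eval_at (B C : comNzRingType) (phi : {rmorphism B -> C}) (x : C) :
    {rmorphism {poly B} -> C} :=
  horner_morph (fun a => mulrC x (phi a) : GRing.comm x (phi a)).

(** c lies in the subring generated by the image of phi and xs.  The iterated
    polynomial rings let properties of finitely generated algebras be proved
    by adjoining one element at a time. *)
Fixpoint gen_over (C : comNzRingType) (xs : seq C) (B : comNzRingType)
    (phi : {rmorphism B -> C}) (c : C) : Prop :=
  if xs is x :: xs' then gen_over xs' (eval_at phi x) c
  else exists b, phi b = c.

Section GenOver.
Variable C : comNzRingType.
Implicit Types (B : comNzRingType) (xs : seq C) (x c : C).

Lemma eval_atC B (phi : {rmorphism B -> C}) x b : eval_at phi x b%:P = phi b.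
Proof. by rewrite /eval_at /= /horner_morph map_polyC hornerC. Qed.

Lemma eval_atX B (phi : {rmorphism B -> C}) x : eval_at phi x 'X = x.
Proof. by rewrite /eval_at /= /horner_morph map_polyX hornerX. Qed.

Lemma gen_over_base xs B (phi : {rmorphism B -> C}) b : gen_over xs phi (phi b).
Proof.
elim: xs B phi b => [|x xs IH] B phi b /=; first by exists b.
by rewrite -(eval_atC phi x); apply: IH.
Qed.

Lemma gen_over_var xs B (phi : {rmorphism B -> C}) x :
  x \in xs -> gen_over xs phi x.
Proof.
elim: xs B phi => //= y xs IH B phi; rewrite inE => /orP [/eqP <-|/IH]; last exact.
by rewrite -{2}(eval_atX phi x); apply: gen_over_base.
Qed.

Lemma gen_overD xs B (phi : {rmorphism B -> C}) c d :
  gen_over xs phi c -> gen_over xs phi d -> gen_over xs phi (c + d).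
Proof.
elim: xs B phi => [|x xs IH] B phi /=; last exact: IH.
by move=> [a <-] [b <-]; exists (a + b); rewrite rmorphD.
Qed.

Lemma gen_overM xs B (phi : {rmorphism B -> C}) c d :
  gen_over xs phi c -> gen_over xs phi d -> gen_over xs phi (c * d).
Proof.
elim: xs B phi => [|x xs IH] B phi /=; last exact: IH.
by move=> [a <-] [b <-]; exists (a * b); rewrite rmorphM.
Qed.

End GenOver.

Lemma mpoly_gen_over (k : fieldType) (n : nat) (C : comNzRingType)
    (pi : {rmorphism {mpoly k[n]} -> C}) xs (B : comNzRingType)
    (phi : {rmorphism B -> C}) :
  (forall c, gen_over xs phi (pi c%:MP)) -> (forall i, gen_over xs phi (pi 'X_i)) ->
  forall p, gen_over xs phi (pi p).
Proof.
move=> gC gX; have g1 : gen_over xs phi 1 by rewrite -(rmorph1 phi); apply: gen_over_base.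
elim/mpolyind => [|c m p _ _ IH]; first by rewrite -mpolyC0.
rewrite rmorphD; apply: gen_overD => //; rewrite -mul_mpolyC rmorphM.
apply: gen_overM => //; rewrite mpolyXE_id rmorph_prod /=.
elim/big_ind: _ => [//|x y|i _]; first exact: gen_overM.
rewrite rmorphXn /=; elim: (m i) => [//|e IHe].
by rewrite exprS; apply: gen_overM.
Qed.

Section Noetherian.
Implicit Types (B C : comNzRingType).

Lemma ideal_span_sub B (s t : seq B) :
  {subset s <= ideal_span t} -> {subset ideal_span s <= ideal_span t}.
Proof.
move=> h; apply: ideal_span_ind => [|x y|a x xs].
- exact: ideal_span0.
- exact: ideal_spanD.
- by apply: ideal_spanM; apply: h.
Qed.

Lemma noetherianP B (I : {pred B}) : noetherian B -> 0 \in I ->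
  (forall a, {in I &, forall u v, a * u + v \in I}) ->
  exists s, I =i ideal_span s.
Proof.
move=> nB I0 hI; have [I1|I1] := boolP (1 \in I); last exact: nB.
exists [:: 1] => x; transitivity true.
  by rewrite -[x]mulr1 -[x * 1]addr0 hI.
by rewrite -[x]mulr1 ideal_spanM // mem_ideal_span // inE.
Qed.

Lemma ideal_span_in B (I : {pred B}) s : 0 \in I ->
  (forall a, {in I &, forall u v, a * u + v \in I}) ->
  {subset s <= I} -> {subset ideal_span s <= I}.
Proof.
move=> I0 hI sI; apply: ideal_span_ind => // [x y xI yI|a x xs].
  by rewrite -[x]mul1r hI.
by rewrite -[a * x]addr0 hI // sI.
Qed.

Lemma noetherian_image B C (phi : {rmorphism B -> C}) :
  (forall c, exists b, phi b = c) -> noetherian B -> noetherian C.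
Proof.
move=> surj nB I [I0 I1 hI].
have [|s hs] := nB [pred b | phi b \in I].
  split; rewrite ?inE ?rmorph0 ?rmorph1 // => a u v uI vI.
  by rewrite inE rmorphD rmorphM hI.
exists (map phi s) => c; apply/idP/idP.
  have [b <-] := surj c => bI.
  have : b \in ideal_span s by rewrite -hs inE.
  move=> /ideal_spanP [a ->]; rewrite rmorph_sum; apply: ideal_span_sum => i _.
  by rewrite rmorphM; apply: ideal_spanM; apply: mem_ideal_span; rewrite map_f ?mem_nth.
apply: ideal_span_in => // _ /mapP [b bs ->].
by have := hs b; rewrite (mem_ideal_span bs) inE.
Qed.

Lemma noetherian_field (k : fieldType) : noetherian k.
Proof.
move=> I [I0 I1 hI]; exists [::] => x; apply/idP/idP.
  have [->|x0] := eqVneq x 0; first by rewrite ideal_span0.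
  move=> xI; case/negP: I1.
  by rewrite -(mulVf x0) -[_ * x]addr0 hI.
by apply: ideal_span_in.
Qed.

(** Hilbert's basis theorem.  Ld d is the ideal of the coefficients of degree d
    of the members of I of degree at most d.  These ideals increase with d and
    are all contained in Ld D for some D, because their union is finitely
    generated.  Lifts of generators of the Ld d with d <= D generate I: the top
    coefficient of a member of I is removed using a combination of the lifts if
    its degree is at most D, and a shifted element of smaller degree
    otherwise. *)
Theorem noetherian_poly B : noetherian B -> noetherian {poly B}.
Proof.
move=> nB I [I0 _ hI].
have ID u v : u \in I -> v \in I -> u + v \in I.
  by move=> uI vI; rewrite -[u]mul1r hI.
have IM a u : u \in I -> a * u \in I by move=> uI; rewrite -[_ * _]addr0 hI.
pose Ld d (a : B) := exists f, [/\ f \in I, (size f <= d.+1)%N & f`_d = a].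
have Ld0 d : Ld d 0 by exists 0; rewrite size_poly0 coef0.
have LdP d a u v : Ld d u -> Ld d v -> Ld d (a * u + v).
  move=> [f [fI sf <-]] [g [gI sg <-]]; exists (a%:P * f + g); split.
  - exact: hI.
  - rewrite (leq_trans (size_polyD _ _)) // geq_max sg andbT.
    by rewrite mul_polyC (leq_trans (size_scale_leq _ _)).
  - by rewrite coefD coefCM.
have LdS d e a : (d <= e)%N -> Ld d a -> Ld e a.
  move=> le [f [fI sf <-]]; exists ('X^(e - d) * f); split.
  - exact: IM.
  - have [->|f0] := eqVneq f 0; first by rewrite mulr0 size_poly0.
    by rewrite mulrC size_mulXn // (leq_trans (leq_add (leqnn _) sf)) // addnS subnK.
  - by rewrite coefXnM ltnNge leq_subr /= subKn.
have [s hs] : exists s, [pred a | `[<exists d, Ld d a>]] =i ideal_span s.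
  apply: noetherianP => //; first by apply/asboolP; exists 0%N.
  move=> a u v /asboolP [d du] /asboolP [e ev]; apply/asboolP.
  by exists (maxn d e); apply: LdP; [apply: LdS du|apply: LdS ev]; rewrite ?leq_maxl ?leq_maxr.
have [D hD] : exists D, forall d a, Ld d a -> Ld D a.
  have : {subset s <= ideal_span s} by move=> x; apply: mem_ideal_span.
  have [D hD] : exists D, forall a, a \in s -> Ld D a.
    have : forall a, a \in s -> exists d, Ld d a.
      by move=> a /mem_ideal_span; rewrite -hs => /asboolP.
    elim: s {hs} => [|a s IH] h; first by exists 0%N.
    have [|D hD] := IH; first by move=> b bs; apply: h; rewrite inE bs orbT.
    have [d da] := h a (mem_head _ _).
    exists (maxn d D) => b; rewrite inE.
    by case/orP => [/eqP->|/hD hb]; [apply: LdS da|apply: LdS hb]; rewrite ?leq_maxl ?leq_maxr.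
  move=> _; exists D => d a da.
  have : a \in ideal_span s by rewrite -hs; apply/asboolP; exists d.
  apply: ideal_span_ind => [||b x xs]; first exact: Ld0.
    by move=> x y Lx Ly; rewrite -[x]mul1r; apply: LdP.
  by rewrite -[b * x]addr0; apply: LdP => //; apply: hD.
pose lifts d (g : seq {poly B}) := {subset g <= I} /\
    forall f, f \in I -> (size f <= d.+1)%N ->
      exists h, [/\ h \in ideal_span g, (size h <= d.+1)%N & h`_d = f`_d].
have [G hG] : {G & forall d, lifts d (G d)}.
  apply: choice => d.
  have [t ht] : exists t, [pred a | `[<Ld d a>]] =i ideal_span t.
    apply: noetherianP => //; first by apply/asboolP; apply: Ld0.
    by move=> a u v /asboolP du /asboolP dv; apply/asboolP; apply: LdP.
  pose lift a (f : {poly B}) := a \in t -> [/\ f \in I, (size f <= d.+1)%N & f`_d = a].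
  have [F hF] : {F & forall a, lift a (F a)}.
    apply: choice => a; have [ta|nta] := boolP (a \in t); last first.
      by exists 0; rewrite /lift (negPf nta).
    have : a \in ideal_span t by apply: mem_ideal_span.
    by rewrite -ht => /asboolP [f hf]; exists f.
  exists (map F t); split=> [_ /mapP [a /hF [FI _ _] -> //]|f fI sf].
  have : f`_d \in ideal_span t by rewrite -ht; apply/asboolP; exists f.
  pose P a := exists h, [/\ h \in ideal_span (map F t), (size h <= d.+1)%N & h`_d = a].
  apply: (@ideal_span_ind _ P) => [|x y [h [hS sh <-]] [g [gS sg <-]]|a x xt].
  - by exists 0; rewrite ideal_span0 size_poly0 coef0.
  - exists (h + g); rewrite ideal_spanD // coefD; split=> //.
    by rewrite (leq_trans (size_polyD _ _)) // geq_max sh.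
  - have [_ sF eF] := hF x xt; exists (a%:P * F x); rewrite coefCM eF; split=> //.
      by apply/ideal_spanM/mem_ideal_span/map_f.
    by rewrite mul_polyC (leq_trans (size_scale_leq _ _)).
pose S := flatten [seq G d | d <- iota 0 D.+1].
have SI : {subset S <= I}.
  by move=> x /flattenP [_ /mapP [d _ ->]]; case: (hG d) => h _; apply: h.
have ISI : {subset ideal_span S <= I} by apply: ideal_span_in.
exists S => f; apply/idP/idP; last exact: ISI.
move: {2}(size f) (leqnn (size f)) => m.
elim/ltn_ind: m f => -[|m] IH f.
  by rewrite leqn0 size_poly_eq0 => /eqP -> _; apply: ideal_span0.
move=> sf fI.
suff [h [hS sh eh]] : exists h, [/\ h \in ideal_span S, (size h <= m.+1)%N & h`_m = f`_m].
  rewrite -(subrK h f) ideal_spanD // (IH m) //; last first.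
    by rewrite addrC -mulN1r hI // ISI.
  apply/leq_sizeP => j; rewrite leq_eqVlt coefB => /orP [/eqP <-|lt].
    by rewrite eh subrr.
  by rewrite !nth_default ?subrr // ?(leq_trans sf) ?(leq_trans sh).
have [le|lt] := leqP m D.
  have [_ /(_ f fI sf) [h [hS sh eh]]] := hG m; exists h; split=> //.
  move: hS; apply: ideal_span_sub => x xG; apply: mem_ideal_span.
  by apply/flattenP; exists (G m) => //; apply: map_f; rewrite mem_iota add0n ltnS.
have [g [gI sg eg]] : Ld D f`_m by apply: (hD m); exists f.
exists ('X^(m - D) * g); split.
- apply: ideal_spanM; apply: (IH D.+1) => //.
- have [->|g0] := eqVneq g 0; first by rewrite mulr0 size_poly0.
  by rewrite mulrC size_mulXn // (leq_trans (leq_add (leqnn _) sg)) // addnS subnK // ltnW.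
- by rewrite coefXnM ltnNge leq_subr /= subKn // ltnW.
Qed.

Theorem noetherian_gen_over C xs B (phi : {rmorphism B -> C}) :
  noetherian B -> (forall c, gen_over xs phi c) -> noetherian C.
Proof.
elim: xs B phi => [|x xs IH] B phi nB h; first exact: (@noetherian_image _ _ phi).
by apply: (IH _ (eval_at phi x)) => //; apply: noetherian_poly.
Qed.

End Noetherian.

(** * Zariski's lemma *)

Section GoldmanDomains.
Variable L : fieldType.
Implicit Types (B : comNzRingType) (S : L -> Prop).

(** For a subring S of a field: inverting a single element b of S already
    inverts all nonzero elements.  Every subfield has this property, with
    b = 1, and it descends along finitely generated extensions. *)
Definition goldman S := exists b, [/\ S b, b != 0 &
  forall a, S a -> a != 0 -> exists m c, S c /\ b ^+ m = a * c].

Definition image_of B (phi : B -> L) c := exists b, phi b = c.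

(** If x were transcendental over the image of B, with b = beta(x), then
    1 + X beta would divide a power of beta although it is prime to beta and of
    positive degree. *)
Lemma goldman_algebraic B (phi : {rmorphism B -> L}) x :
  goldman (image_of (eval_at phi x)) ->
  exists2 p, map_poly phi p != 0 & eval_at phi x p = 0.
Proof.
case=> b [[beta eb] b0 hb]; apply/not_exists2P => transc.
have inj p : eval_at phi x p = 0 -> map_poly phi p = 0.
  by move=> p0; apply/eqP/negPn/negP => np; case: (transc p) => //; rewrite ?np.
pose P := map_poly phi beta.
have P0 : P != 0.
  apply: contraNneq b0 => P0; rewrite -eb.
  by rewrite /eval_at /= /horner_morph -/P P0 horner0.
have mapX : map_poly phi (1 + 'X * beta) = 1 + 'X * P.
  by rewrite rmorphD rmorph1 rmorphM /= map_polyX.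
have sX : size ('X * P) = (size P).+1 by rewrite mulrC size_mulX.
have s1 : size (1 + 'X * P) = (size P).+1.
  by rewrite addrC size_polyDl sX // size_poly1 ltnS size_poly_gt0.
have a0 : eval_at phi x (1 + 'X * beta) != 0.
  apply/eqP => /inj; rewrite mapX => /eqP; rewrite -size_poly_eq0 s1 //.
have [m [_ [[gamma <-]]]] := hb _ (ex_intro _ _ erefl) a0.
rewrite -eb -rmorphXn -rmorphM => /eqP; rewrite -subr_eq0 -rmorphB => /eqP /inj.
rewrite rmorphB rmorphXn rmorphM /= mapX -/P => /eqP; rewrite subr_eq0 => /eqP ePm.
have cop : coprimep (1 + 'X * P) (P ^+ m).
  apply: coprimep_expr; apply/Bezout_eq1_coprimepP.
  by exists (1, - 'X) => /=; rewrite mul1r mulNr addrK.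
have /(coprimep_dvdl)/(_ cop) : (1 + 'X * P) %| P ^+ m by rewrite ePm dvdp_mulr.
by rewrite coprimepp s1 eqSS size_poly_eq0 (negPf P0).
Qed.

(** Divide a monic equation of y by y, after removing the factors X that its
    vanishing lower coefficients allow: the constant coefficient b that remains
    gives b / y as a polynomial in y. *)
Lemma integral_inverse B (phi : {rmorphism B -> L}) y :
  integralOver phi y -> y != 0 ->
  exists2 b, phi b != 0 & integralOver phi (phi b / y).
Proof.
case=> Q mQ rQ y0; elim/poly_ind: Q mQ rQ => [|Q c IH] mQ rQ.
  by move: mQ; rewrite monicE lead_coef0 eq_sym oner_eq0.
have ev : (map_poly phi Q).[y] * y + phi c = 0.
  move/rootP: rQ; rewrite rmorphD rmorphM /= map_polyX map_polyC.
  by rewrite hornerD hornerMX hornerC.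
have [c0|nc] := eqVneq (phi c) 0.
  have [Q0|nQ] := eqVneq Q 0.
    move: mQ; rewrite Q0 mul0r add0r monicE lead_coefC => /eqP c1.
    by move: c0; rewrite c1 rmorph1 => /eqP; rewrite oner_eq0.
  apply: IH.
    move: mQ; rewrite !monicE lead_coefDl ?lead_coefMX //.
    by rewrite size_mulX // size_polyC; case: eqP; rewrite //= ltnS size_poly_gt0.
  by apply/rootP/eqP; move/eqP: ev; rewrite c0 addr0 mulf_eq0 (negPf y0) orbF.
exists c => //.
have -> : phi c / y = - (map_poly phi Q).[y].
  apply: (mulIf y0); rewrite mulfVK // mulNr; apply/eqP.
  by rewrite -addr_eq0 addrC ev.
apply: integral_opp; apply: integral_horner; last by exists (Q * 'X + c%:P).
apply/integral_poly => i; rewrite coef_map; exact: integral_id.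
Qed.

(** A denominator b0 that makes x integral makes every polynomial in x integral
    after taking a suitable power. *)
Lemma integral_clear B (phi : {rmorphism B -> L}) x b0 p :
  integralOver phi (phi b0 * x) ->
  exists N, integralOver phi (phi b0 ^+ N * eval_at phi x p).
Proof.
move=> ix; elim/poly_ind: p => [|p c [N IH]].
  by exists 0%N; rewrite rmorph0 mulr0; apply: integral0.
exists N.+1; rewrite rmorphD rmorphM /= eval_atX eval_atC mulrDr.
apply: integral_add.
  by rewrite exprSr mulrACA; apply: integral_mul.
by rewrite -rmorphXn -rmorphM; apply: integral_id.
Qed.

Lemma integral_exp B (phi : {rmorphism B -> L}) y e :
  integralOver phi y -> integralOver phi (y ^+ e).
Proof.
move=> iy; elim: e => [|e IH]; first exact: integral1.
by rewrite exprS; apply: integral_mul.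
Qed.

(** The leading coefficient b of an equation of x, multiplied into it often
    enough, turns it into a monic equation of b x. *)
Lemma integral_lead B (phi : {rmorphism B -> L}) x p :
  map_poly phi p != 0 -> eval_at phi x p = 0 ->
  exists2 b, phi b != 0 & integralOver phi (phi b * x).
Proof.
set P := map_poly phi p => P0 px; pose s := (size P).-1.
have sP : size P = s.+1 by rewrite prednK // size_poly_gt0.
exists (p`_s).
  by rewrite -coef_map -/P /s -lead_coefE lead_coef_eq0.
set b := p`_s; pose cf i := p`_i * b ^+ (s.-1 - i); pose Q := 'X^s + \poly_(i < s) cf i.
have sQ : (size (\poly_(i < s) cf i) < size ('X^s : {poly B}))%N.
  by rewrite size_polyXn ltnS size_poly.
exists Q; first by rewrite monicE lead_coefDl // lead_coefXn.
apply/rootP; rewrite rmorphD /= map_polyXn hornerD hornerXn.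
have -> : map_poly phi (\poly_(i < s) cf i) =
          \poly_(i < s) phi (cf i).
  by apply/polyP => i; rewrite coef_map !coef_poly; case: ifP => // _; apply: rmorph0.
rewrite horner_poly.
have [s0|s0] := posnP s.
  rewrite s0 big_ord0 expr0 addr0; move: px.
  rewrite /eval_at /= /horner_morph -/P horner_coef sP s0 big_ord1 expr0 mulr1.
  move=> e; move: P0; rewrite -size_poly_eq0 sP s0 => _.
  have := lead_coef_eq0 P; rewrite lead_coefE sP s0 /= e eqxx.
  by move/esym/eqP => P0; move: sP; rewrite P0 size_poly0.
transitivity (phi b ^+ s.-1 * P.[x]); last first.
  by move: px; rewrite /eval_at /= /horner_morph -/P => ->; rewrite mulr0.
rewrite horner_coef sP big_ord_recr /= mulrDr addrC mulr_sumr; congr (_ + _).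
  apply: eq_bigr => i _; rewrite /P coef_map /cf rmorphM rmorphXn exprMn /=.
  have -> : phi b ^+ s.-1 = phi b ^+ (s.-1 - i) * phi b ^+ i.
    by rewrite -exprD subnK // -ltnS prednK.
  ring.
by rewrite coef_map -/b mulrA -exprSr prednK // exprMn.
Qed.

(** Multiply a monic equation of z / a by the right power of a: all terms but
    the first are multiples of a. *)
Lemma integral_quotient B (phi : {rmorphism B -> L}) z a :
  phi a != 0 -> integralOver phi (phi z / phi a) ->
  exists e c, phi z ^+ e = phi a * phi c.
Proof.
move=> a0 [Q mQ /rootP rQ]; pose s := (size Q).-1.
have sQ : size Q = s.+1 by rewrite prednK // size_poly_gt0 monic_neq0.
have qs : Q`_s = 1 by move/monicP: mQ; rewrite lead_coefE.
exists s, (- \sum_(i < s) Q`_i * z ^+ i * a ^+ (s.-1 - i)).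
have qs' : (map_poly phi Q)`_s = 1 by rewrite coef_map qs; apply: rmorph1.
move: rQ; rewrite horner_coef size_map_poly_id0; last first.
  by rewrite (monicP mQ) rmorph1 oner_eq0.
rewrite sQ big_ord_recr /= qs' mul1r => /(congr1 ( *%R (phi a ^+ s))).
rewrite mulr0 mulrDr exprMn exprVn mulrCA divff ?expf_neq0 // mulr1 => /eqP.
rewrite addrC addr_eq0 => /eqP ->; rewrite rmorphN mulrN; congr (- _).
rewrite rmorph_sum !mulr_sumr; apply: eq_bigr => i _.
rewrite coef_map !rmorphM !rmorphXn exprMn exprVn.
have -> : phi a ^+ s = phi a * phi a ^+ (s.-1 - i) * phi a ^+ i.
  rewrite -exprS -exprD; congr (_ ^+ _).
  rewrite addSn subnK ?prednK //; first exact: leq_ltn_trans (ltn_ord i).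
  by rewrite -ltnS prednK // (leq_ltn_trans _ (ltn_ord i)).
rewrite -!mulrA; congr (_ * _).
rewrite [RHS]mulrA [RHS]mulrC; congr (_ * _).
by rewrite mulrCA; congr (_ * _); rewrite mulrCA divff ?mulr1 // expf_neq0.
Qed.

(** By goldman_algebraic x is algebraic, so a multiple b0 x is integral.  If
    c' = beta(x) works over the extension, choose b1 with b1 / (b0^N c')
    integral.  Then 1 / a, for a in the image of phi, becomes integral
    after multiplication by a power of b0 b1, since a divides a power of c';
    and integral_quotient concludes. *)
Lemma goldman_descend B (phi : {rmorphism B -> L}) x :
  goldman (image_of (eval_at phi x)) -> goldman (image_of phi).
Proof.
move=> gx; have [p P0 px] := goldman_algebraic gx.
have [b0 b00 ix] := integral_lead P0 px.
case: gx => c' [[beta eb] c'0 hc].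
have [N] := integral_clear beta ix; rewrite eb; set y := _ * c' => iy.
have y0 : y != 0 by rewrite mulf_neq0 ?expf_neq0.
have [b1 b10 iy1] := integral_inverse iy y0.
exists (phi (b0 * b1)); split; first by exists (b0 * b1).
  by rewrite rmorphM mulf_neq0.
move=> _ [a <-] a0.
have [] := hc (phi a) _ a0; first by exists a%:P; rewrite eval_atC.
move=> m [_ [[gamma <-] e]].
have [M ig] := integral_clear gamma ix.
suff : integralOver phi (phi ((b0 * b1) ^+ (M + m)) / phi a).
  move/(integral_quotient a0) => [d [c ec]].
  exists ((M + m) * d)%N, (phi c); split; first by exists c.
  by rewrite exprM -rmorphXn.
have -> : phi ((b0 * b1) ^+ (M + m)) / phi a =
   (phi b0 ^+ M * eval_at phi x gamma) * (phi b1 / y) ^+ m *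
   phi (b0 ^+ N ^+ m * b0 ^+ m * b1 ^+ M).
  have -> : eval_at phi x gamma = c' ^+ m / phi a.
    by rewrite e mulrAC divff // mul1r.
  rewrite !rmorphM !rmorphXn rmorphM /y !exprMn !exprD exprVn !exprMn.
  rewrite invfM.
  have u : c' ^+ m != 0 by rewrite expf_neq0.
  have v : phi b0 ^+ N ^+ m != 0 by rewrite !expf_neq0.
  by field; rewrite u v a0.
apply: integral_mul; last exact: integral_id.
by apply: integral_mul => //; apply: integral_exp.
Qed.

Lemma goldman_gen_over xs B (phi : {rmorphism B -> L}) :
  goldman (gen_over xs phi) -> goldman (image_of phi).
Proof.
elim: xs B phi => [//|x xs IH] B phi /= /IH; exact: goldman_descend.
Qed.

(** The residue field is generated by the images of theta and of the variables;
    as a field it is a Goldman domain, and the property descends to the image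
    of k[X] under X |-> theta, so goldman_algebraic applies. *)
Theorem zariski (k : fieldType) n (pi : {rmorphism {mpoly k[n]} -> L}) theta :
  (forall y, exists f, pi f = y) ->
  exists2 p : {poly k}, p != 0 & (map_poly (pi \o mpolyC n (R := k)) p).[theta] = 0.
Proof.
move=> surj; pose phi := eval_at (pi \o mpolyC n (R := k)) theta.
pose xs := [seq pi 'X_i | i <- enum 'I_n].
have gen y : gen_over xs phi y.
  have [f <-] := surj y; apply: mpoly_gen_over => [c|i].
    by have := gen_over_base xs phi c%:P; rewrite eval_atC.
  by apply: gen_over_var; apply/mapP; exists i; rewrite ?mem_enum.
have : goldman (gen_over xs phi).
  exists 1; split=> [||a _ a0]; [exact: gen|exact: oner_neq0|].
  by exists 0%N, a^-1; split; [apply: gen|rewrite divff].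
move=> /goldman_gen_over /goldman_algebraic [p p0 pt]; exists p => //.
by apply: contraNneq p0 => ->; rewrite map_poly0.
Qed.

End GoldmanDomains.

Lemma ideal_absorb (A : comNzRingType) (I : {pred A}) a x :
  idealr_closed I -> x \in I -> a * x \in I.
Proof. by move=> /ideal_weak /weak_ideal_absorb; apply. Qed.

Lemma ideal_add (A : comNzRingType) (I : {pred A}) x y :
  idealr_closed I -> x \in I -> y \in I -> x + y \in I.
Proof. by move=> /ideal_weak /weak_ideal_add; apply. Qed.

Lemma ideal_sub (A : comNzRingType) (I : {pred A}) x y :
  idealr_closed I -> x \in I -> y \in I -> x - y \in I.
Proof. by move=> hI xI yI; rewrite ideal_add // -mulN1r ideal_absorb. Qed.

Lemma maximal_invertible (A : comNzRingType) (M : {pred A}) a :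
  maximal_ideal M -> a \notin M -> exists b, b * a - 1 \in M.
Proof.
move=> [hM maxM] aM; have [M0 M1 _] := hM.
pose J : {pred A} := [pred x | `[<exists b, b * a - x \in M>]].
have inJ x : (x \in J) = `[<exists b, b * a - x \in M>] by [].
have [|J1] := boolP (1 \in J); first by rewrite inJ => /asboolP.
have hJ : idealr_closed J.
  split=> //; first by rewrite inJ; apply/asboolP; exists 0; rewrite mul0r subr0.
  move=> c u v; rewrite !inJ => /asboolP [b bu] /asboolP [d dv]; apply/asboolP.
  exists (c * b + d).
  have -> : (c * b + d) * a - (c * u + v) = c * (b * a - u) + (d * a - v) by ring.
  by apply: ideal_add => //; apply: ideal_absorb.
case/negP: aM; apply: (maxM J hJ) => [x xM|]; rewrite inJ; apply/asboolP.
  by exists 0; rewrite mul0r sub0r -mulN1r ideal_absorb.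
by exists 1; rewrite mul1r subrr.
Qed.

Lemma maximal_prime (A : comNzRingType) (M : {pred A}) :
  maximal_ideal M -> prime_ideal M.
Proof.
move=> maxM; have hM := maxM.1; split=> // u v uv; apply/orP.
have [|/(maximal_invertible maxM) [b bu]] := boolP (u \in M); first by left.
right; have -> : v = b * (u * v) - v * (b * u - 1) by ring.
by apply: ideal_sub => //; apply: ideal_absorb.
Qed.

Section ResidueField.
Variables (A : comNzRingType) (M : {pred A}) (maxM : maximal_ideal M).

(** A copy of M keyed on the proof of maximality, so that the quotient by it can
    be found by canonical structure inference. *)
Definition max_pred (_ : maximal_ideal M) : {pred A} := M.

HB.instance Definition _ := isIdealr.Build A (max_pred maxM) (proj1 maxM).

Definition residue_field : Type := {ideal_quot (max_pred maxM)}.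

HB.instance Definition _ := GRing.ComNzRing.on residue_field.

Definition residue : {rmorphism A -> residue_field} :=
  \pi_({ideal_quot (max_pred maxM)})%qT.

Lemma residue_surj y : exists a, residue a = y.
Proof. by exists (repr (y : {ideal_quot (max_pred maxM)})); apply: reprK. Qed.

Lemma residue_eq0 a : (residue a == 0) = (a \in M).
Proof.
rewrite -[0](rmorph0 residue) -[LHS](Quotient.idealrBE (max_pred maxM)).
by rewrite subr0.
Qed.

Lemma residue_inverse (x : residue_field) :
  exists y, (x != 0 -> y * x = 1) /\ (x = 0 -> y = 0).
Proof.
have [->|x0] := eqVneq x 0; first by exists 0; split.
move: (x0); have [a ea] := residue_surj x; rewrite -{1}ea residue_eq0.
move=> /(maximal_invertible maxM) [b ba].
exists (residue b); split=> [_|x0']; last by rewrite x0' eqxx in x0.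
rewrite -ea; apply/eqP; rewrite -rmorphM -subr_eq0 -[1](rmorph1 residue).
by rewrite -rmorphB residue_eq0.
Qed.

Definition residue_inv (x : residue_field) : residue_field :=
  sval (cid (residue_inverse x)).

Fact residue_mulVf (x : residue_field) : x != 0 -> residue_inv x * x = 1.
Proof. by rewrite /residue_inv; case: cid => y [/= h _]; apply: h. Qed.

Fact residue_inv0 : residue_inv 0 = 0.
Proof. by rewrite /residue_inv; case: cid => y [/= _]; apply. Qed.

HB.instance Definition _ :=
  GRing.ComNzRing_isField.Build residue_field residue_mulVf residue_inv0.

End ResidueField.

Theorem maximal_algebraic (k : fieldType) n (A : comNzRingType)
    (pi : {rmorphism {mpoly k[n]} -> A}) (M : {pred A}) f :
  (forall a, exists g, pi g = a) -> maximal_ideal M ->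
  exists2 p : {poly k}, p \is monic &
    pi (map_poly (mpolyC n (R := k)) p).[f] \in M.
Proof.
move=> surj maxM.
have [y|p p0 pt] := @zariski (residue_field maxM) k n (residue maxM \o pi) (residue maxM (pi f)).
  have [a <-] := residue_surj y; have [g <-] := surj a; by exists g.
exists ((lead_coef p)^-1 *: p).
  by rewrite monicE lead_coefZ mulVf // lead_coef_eq0.
rewrite map_polyZ hornerZ rmorphM /= -residue_eq0 rmorphM mulf_eq0.
apply/orP; right; move: pt; rewrite map_poly_comp.
rewrite -[residue maxM (pi f)]/((residue maxM \o pi) f) horner_map => pt.
by apply/eqP.
Qed.

(** * Prime chains from regular sequences *)

Section PrimeChains.
Variable A : comNzRingType.
Implicit Types (I J P Q M : {pred A}) (s : seq A).

(** Zorn's lemma gives an ideal maximal among those containing J and avoiding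
    the multiplicative set S; such an ideal is prime. *)
Lemma krull_separation J (S : A -> Prop) : weak_ideal J ->
  S 1 -> (forall x y, S x -> S y -> S (x * y)) -> (forall x, S x -> x \notin J) ->
  exists P, [/\ prime_ideal P, {subset J <= P} & forall x, S x -> x \notin P].
Proof.
move=> hJ S1 SM SJ.
pose good I := [/\ weak_ideal I, {subset J <= I} & forall x, S x -> x \notin I].
pose T := {I : A -> bool | good I}.
pose R (I I' : T) := `[< {subset sval I <= sval I'} >].
have goodJ : good J by split.
have Rrefl t : R t t by apply/asboolP.
have Rtrans r t u : R r t -> R t u -> R r u.
  by move=> /asboolP h1 /asboolP h2; apply/asboolP => x /h1 /h2.
have [Ch totCh|t maxt] := @classical_sets.ZL_preorder T (exist _ J goodJ) R Rrefl Rtrans.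
  have [[t0 Cht0]|noCh] := pselect (exists t, Ch t); last first.
    by exists (exist _ J goodJ) => t Cht; case: noCh; exists t.
  pose U : {pred A} := [pred x | `[< exists2 t, Ch t & x \in sval t >]].
  have inU x : (x \in U) = `[< exists2 t, Ch t & x \in sval t >] by [].
  have goodU : good U.
    split; first split.
    - by rewrite inU; apply/asboolP; exists t0 => //; case: (svalP t0) => -[].
    - move=> a u v; rewrite !inU => /asboolP [t Cht ut] /asboolP [r Chr vr].
      apply/asboolP; have [/asboolP h|/asboolP h] := totCh t r Cht Chr.
        exists r => //; case: (svalP r) => -[_ hr] _ _; apply: hr => //; exact: h.
      exists t => //; case: (svalP t) => -[_ ht] _ _; apply: ht => //; exact: h.
    - move=> x xJ; rewrite inU; apply/asboolP; exists t0 => //.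
      by case: (svalP t0) => _ h _; apply: h.
    - move=> x Sx; rewrite inU; apply/asboolPn => -[t _].
      by apply/negP; case: (svalP t) => _ _; apply.
  exists (exist _ U goodU) => t Cht; apply/asboolP => x xt /=.
  by rewrite inU; apply/asboolP; exists t.
case: t maxt => P goodP maxP; have [hP JP SP] := goodP; exists P; split=> //.
have P1 : 1 \notin P by apply: SP.
split; first by case: hP.
(* the ideal generated by P and u is larger than P, hence meets S *)
have meetS u : u \notin P -> exists a p, p \in P /\ S (a * u + p).
  move=> uP; pose I : {pred A} := [pred x | `[< exists a p, p \in P /\ x = a * u + p >]].
  have inI x : (x \in I) = `[< exists a p, p \in P /\ x = a * u + p >] by [].
  have PI : {subset P <= I}.
    by move=> x xP; rewrite inI; apply/asboolP; exists 0, x; rewrite mul0r add0r.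
  have [goodI|] := pselect (good I).
    case/negP: uP; have /asboolP /= := maxP (exist _ I goodI) (introT (asboolP _) PI).
    apply; rewrite inI; apply/asboolP; exists 1, 0; rewrite mul1r addr0.
    by case: hP.
  move=> badI; apply: contrapT => noS; apply: badI; split; first split.
  - by apply: PI; case: hP.
  - move=> c x y; rewrite !inI => /asboolP [a [p [pP ->]]] /asboolP [b [r [rP ->]]].
    apply/asboolP; exists (c * a + b), (c * p + r); split; last by ring.
    by case: hP => _; apply.
  - by move=> x /JP /PI.
  - move=> x Sx; rewrite inI; apply/asboolPn => -[a [p [pP ex]]]; apply: noS.
    by exists a, p; rewrite -ex.
move=> u v uv; apply/orP; apply: contrapT => /not_orP [/negP uP /negP vP].
have [a [p [pP Su]]] := meetS u uP; have [b [r [rP Sv]]] := meetS v vP.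
have := SP _ (SM _ _ Su Sv); apply/negP/negPn.
have -> : (a * u + p) * (b * v + r) = a * b * (u * v) + ((b * v + r) * p + (a * u) * r) by ring.
have add := weak_ideal_add hP; have abs := weak_ideal_absorb _ hP.
by apply: (add); [apply: abs|apply: add; apply: abs].
Qed.

(** The products t x^m with t outside Q avoid J, since x is a nonzerodivisor
    modulo J.  A prime avoiding all of them lies in Q and misses x. *)
Lemma prime_below Q J x : prime_ideal Q -> weak_ideal J -> {subset J <= Q} ->
  x \in Q -> (forall y, x * y \in J -> y \in J) ->
  exists P, [/\ prime_ideal P, {subset J <= P} & strict_subset P Q].
Proof.
move=> [hQ pQ] hJ JQ xQ reg; have [_ Q1 _] := hQ.
pose S z := exists t m, t \notin Q /\ z = t * x ^+ m.
have [|||P [pP JP SP]] := @krull_separation J S hJ.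
- by exists 1, 0%N; rewrite mulr1.
- move=> _ _ [t [m [tQ ->]]] [t' [m' [tQ' ->]]]; exists (t * t'), (m + m')%N.
  split; last by rewrite exprD mulrACA.
  by apply/negP => /pQ; rewrite (negPf tQ) (negPf tQ').
- move=> _ [t [m [tQ ->]]]; elim: m => [|m IH].
    by rewrite mulr1; apply: contra tQ => /JQ.
  by rewrite exprS mulrCA; apply: contra IH => /reg.
exists P; split=> //; split.
  move=> y; apply: contraTT => yQ; apply: SP; exists y, 0%N.
  by rewrite mulr1.
move=> QP; have := SP x; rewrite (QP x xQ) => h.
by have : ~~ true by apply: h; exists 1, 1%N; rewrite mul1r.
Qed.

(** Descend along the sequence: prime_below replaces a prime containing the
    first i + 1 terms by a smaller one containing the first i. *)
Theorem regular_sequence_chain P s : prime_ideal P -> regular_sequence s ->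
  {subset s <= P} -> exists c, prime_chain_from P (size s) c.
Proof.
move=> + [reg _]; move: P.
suff gen i : (i <= size s)%N -> forall P, prime_ideal P ->
    {subset take i s <= P} -> exists c, prime_chain_from P i c.
  by move=> P pP sP; apply: (gen _ (leqnn _)); rewrite // take_size.
elim: i => [|i IH] le P pP sP.
  by exists (fun=> P); split=> // i; rewrite leqn0.
have nthP : s`_i \in P.
  apply: sP; rewrite -(nth_take 0 (ltnSn i)) mem_nth // size_takel //.
have spanP : {subset ideal_span (take i s) <= P}.
  have [wP _] := pP; have [P0 _ hP] := wP.
  apply: ideal_span_in => // y yt; apply: sP.
  by rewrite (take_nth 0 le) mem_rcons inE yt orbT.
have [Q [pQ JQ ltQP]] :=
  prime_below pP (weak_ideal_span (take i s)) spanP nthP (reg i le).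
have [|c [c0 cP cS]] := IH (ltnW le) Q pQ.
  by move=> y yt; apply: JQ; apply: mem_ideal_span.
exists (fun j => if j is j'.+1 then c j' else P); split=> // [[|j]|[|j]] //.
- by move=> lj; apply: cP.
- move=> _; split=> [x|h]; first by rewrite c0; case: ltQP => h _; apply: h.
  by case: ltQP => _; apply=> x /h; rewrite c0.
- by move=> lj; apply: cS.
Qed.

End PrimeChains.

(** * A bound on the length of prime chains *)

Fixpoint words (N m : nat) : seq (seq nat) :=
  if m is m'.+1 then [seq i :: s | i <- iota 0 N, s <- words N m'] else [:: [::]].

Lemma size_words N m : size (words N m) = (N ^ m)%N.
Proof. by elim: m => //= m IH; rewrite size_allpairs size_iota IH expnS. Qed.

Lemma uniq_words N m : uniq (words N m).
Proof.
elim: m => //= m IH; apply: allpairs_uniq => //; first exact: iota_uniq.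
by move=> [i s] [j t] _ _ [-> ->].
Qed.

Lemma mem_words N m s : (s \in words N m) = (size s == m) && all (gtn N) s.
Proof.
elim: m s => [|m IH] [|i s] //=; first by apply/allpairsP => -[[j t] []].
apply/allpairsP/idP => [[[j t] /= [jN tm [-> ->]]]|/and3P [sm iN sN]].
  by move: jN tm; rewrite mem_iota IH eqSS => /= -> /andP [-> ->].
by exists (i, s); rewrite mem_iota IH /= -(eqSS (size s)) sm iN sN.
Qed.

Section PolynomialValues.
Variables (k : fieldType) (C : comNzRingType) (phi : {rmorphism k -> C}).
Implicit Types (xs : seq C) (cf : seq nat -> k).

(** The value at xs of the polynomial with exponents below N whose coefficients
    are cf, in nested form: the first exponent is the outer sum. *)
Fixpoint poly_value N xs cf : C :=
  if xs is x :: xs' then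
    \sum_(0 <= i < N) x ^+ i * poly_value N xs' (fun s => cf (i :: s))
  else phi (cf [::]).

Fixpoint word_value xs (s : seq nat) : C :=
  if xs is x :: xs' then x ^+ head 0%N s * word_value xs' (behead s) else 1.

Lemma poly_valueE N xs cf : poly_value N xs cf =
  \sum_(s <- words N (size xs)) phi (cf s) * word_value xs s.
Proof.
elim: xs cf => [|x xs IH] cf /=; first by rewrite big_seq1 mulr1.
rewrite big_allpairs_dep /index_iota subn0; apply: eq_bigr => i _.
by rewrite IH mulr_sumr; apply: eq_bigr => s _ /=; rewrite mulrCA.
Qed.

(** Values at xs of a nonzero polynomial, written so as to exhibit its
    lexicographically least monomial: y = x^m (z + x t) with z again such a
    value at the remaining arguments.  This is the identity by which Coquand and
    Lombardi characterize Krull dimension. *)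
Fixpoint nonzero_value xs y : Prop :=
  if xs is x :: xs' then
    exists m z t, nonzero_value xs' z /\ y = x ^+ m * (z + x * t)
  else exists2 c, c != 0 & y = phi c.

(** Factor out the least power of the first argument that carries a nonzero
    coefficient. *)
Lemma poly_value_nonzero N xs cf s : s \in words N (size xs) -> cf s != 0 ->
  nonzero_value xs (poly_value N xs cf).
Proof.
elim: xs cf s => [|x xs IH] cf s.
  by rewrite mem_seq1 => /eqP -> c0; exists (cf [::]).
rewrite mem_words => sw c0.
pose hit i := `[< exists2 t, t \in words N (size xs) & cf (i :: t) != 0 >].
have exhit : exists i, (i < N)%N && hit i.
  case: s sw c0 => //= i s /and3P [sz iN sN] c0; exists i; rewrite iN /=.
  by apply/asboolP; exists s; rewrite // mem_words -(eqSS (size s)) sz.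
case: (ex_minnP exhit) => i /andP [iN /asboolP [t tw ct]] mini.
have low j : (j < i)%N -> poly_value N xs (fun s => cf (j :: s)) = 0.
  move=> ji; rewrite poly_valueE big_seq big1 // => r rw.
  have [->|cr] := eqVneq (cf (j :: r)) 0; first by rewrite rmorph0 mul0r.
  have := mini j; rewrite (ltn_trans ji iN) /= leqNgt ji => h.
  by have // : ~~ true by apply: h; apply/asboolP; exists r.
exists i, (poly_value N xs (fun s => cf (i :: s))).
exists (\sum_(i.+1 <= j < N) x ^+ (j - i.+1) * poly_value N xs (fun s => cf (j :: s))).
split; first exact: IH tw ct.
rewrite /= (big_cat_nat (n := i)) //=; last exact: ltnW.
rewrite big_nat big1 => [|j /andP [_ /low ->]]; last by rewrite mulr0.
rewrite add0r big_ltn // mulrDr mulrA -exprSr mulr_sumr; congr (_ + _).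
rewrite big_nat [RHS]big_nat; apply: eq_bigr => j /andP [ij _].
by rewrite mulrA -exprD subnKC.
Qed.

End PolynomialValues.

Lemma poly_value_morph (k : fieldType) (C C' : comNzRingType)
    (phi : {rmorphism k -> C}) (pi : {rmorphism C -> C'}) N xs cf :
  pi (poly_value phi N xs cf) = poly_value (pi \o phi) N (map pi xs) cf.
Proof.
elim: xs cf => [//|x xs IH] cf /=; rewrite rmorph_sum; apply: eq_bigr => i _.
by rewrite rmorphM rmorphXn IH.
Qed.

(** If x is not in the prime c j but in the next larger one, a relation
    x^m (z + x t) in c j puts z in that larger prime; after the last argument
    a nonzero constant would be in a prime. *)
Lemma nonzero_value_chain (k : fieldType) (A : comNzRingType)
    (phi : {rmorphism k -> A}) (c : nat -> {pred A}) (xs : seq A) j y :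
  (forall i, (i <= j)%N -> prime_ideal (c i)) ->
  (forall i, (i < j)%N -> {subset c i.+1 <= c i}) ->
  (size xs <= j)%N ->
  (forall l, (l < size xs)%N -> xs`_l \in c (j - l.+1)%N /\ xs`_l \notin c (j - l)%N) ->
  nonzero_value phi xs y -> y \notin c j.
Proof.
elim: xs j y => [|x xs IH] j y pc sc szj hx /=.
  case=> b b0 ->; have [hI _] := pc j (leqnn j); apply/negP => yI.
  have [_ /negP I1 _] := hI; apply: I1.
  by rewrite -(rmorph1 phi) -(mulVf b0) rmorphM ideal_absorb.
case=> m [z [t [zv ->]]]; case: j pc sc szj hx => // j pc sc szj hx.
have [xj xNj] := hx 0%N isT; rewrite /= subn1 subn0 in xj xNj.
have zN : z \notin c j.
  apply: IH zv => //.
  - by move=> i ij; apply: pc; apply: leqW.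
  - by move=> i ij; apply: sc; apply: leqW.
  - by move=> l lx; have := hx l.+1 lx; rewrite /= !subSS.
have [hI pI] := pc j.+1 (leqnn _); have [hJ _] := pc j (leqnSn j).
apply/negP; elim: m => [|m IHm]; last first.
  by rewrite exprS -mulrA => /pI; rewrite (negPf xNj).
rewrite mul1r => /(sc j (ltnSn j)) h; case/negP: zN.
rewrite -(addrK (x * t) z); apply: ideal_sub => //.
by rewrite mulrC; apply: ideal_absorb.
Qed.

Section Dependence.
Variables (k : fieldType) (n : nat) (V : {set 'I_n}).
Notation R := {mpoly k[n]}.
Implicit Types (fs : seq R).

Lemma msizeM_pred (f g : R) : (msize (f * g) <= (msize f + msize g).-1)%N.
Proof.
have [->|f0] := eqVneq f 0; first by rewrite mul0r msize0.
have [->|g0] := eqVneq g 0; first by rewrite mulr0 msize0.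
by rewrite msizeM.
Qed.

Lemma msizeX_le (f : R) e i : (msize f <= e.+1)%N -> (msize (f ^+ i) <= (i * e).+1)%N.
Proof.
move=> sf; elim: i => [|i IH]; first by rewrite expr0 msize1.
rewrite exprS (leq_trans (msizeM_pred _ _)) // mulSn.
by move: (leq_add sf IH); rewrite addSn addnS; case: (msize f + _)%N.
Qed.

Lemma msize_word fs e N s : {in fs, forall f, msize f <= e.+1}%N ->
  s \in words N (size fs) -> (msize (word_value fs s) <= (size fs * (N * e)).+1)%N.
Proof.
elim: fs s => [|f fs IH] s hf; first by rewrite /= msize1.
rewrite mem_words; case: s => [//|i s] /= /and3P [ss iN sN].
rewrite (leq_trans (msizeM_pred _ _)) //.
have h1 : (msize (f ^+ i) <= (N * e).+1)%N.
  apply: leq_trans (msizeX_le _ (hf f (mem_head _ _))) _.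
  by rewrite ltnS leq_mul2r ltnW ?orbT.
have h2 : (msize (word_value fs s) <= (size fs * (N * e)).+1)%N.
  apply: IH => [g gf|]; first by apply: hf; rewrite inE gf orbT.
  by rewrite mem_words -(eqSS (size s)) ss.
by move: (leq_add h1 h2); rewrite addSn addnS mulSn; case: (msize _ + _)%N.
Qed.

(** There are N^(size fs) products of powers below N of the fs, and their
    coefficients at monomials free of V live in a space of dimension at most
    (q N)^d, where d = #|~: V| < size fs and q is independent of N.  For
    N = q^d + 1 the first number is larger, so the linear map reading off
    these coefficients has a kernel. *)
Lemma poly_value_dependent fs : (#|~: V| < size fs)%N ->
  exists N (cf : seq nat -> k) s, [/\ s \in words N (size fs), cf s != 0 &
    forall m : 'X_{1..n}, (forall i, i \in V -> m i = 0%N) ->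
      (poly_value (mpolyC n (R := k)) N fs cf)@_m = 0].
Proof.
move=> ltd; pose d := #|~: V|; pose e := (\max_(f <- fs) msize f)%N.
have fe : {in fs, forall f, msize f <= e.+1}%N.
  by move=> f ff; rewrite leqW // /e (big_rem f) //= leq_max leqnn.
pose q := (size fs * e).+1; pose N := (q ^ d).+1.
pose B := (size fs * (N * e)).+1.
pose T := {ffun {i : 'I_n | i \notin V} -> 'I_B}.
have cardT : (#|T| < N ^ size fs)%N.
  have -> : #|T| = (B ^ d)%N.
    rewrite card_ffun card_ord card_sig; congr (_ ^ _)%N.
    by rewrite /d; apply: eq_card => i; rewrite !inE.
  have le : (B <= N * q)%N.
    by rewrite /B /q mulnS mulnCA -addn1 addnC leq_add.
  apply: (@leq_ltn_trans ((N * q) ^ d)%N).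
    by case: (d) => // d'; rewrite leq_exp2r.
  rewrite expnMn; apply: (@leq_trans (N ^ d.+1)%N).
    by rewrite expnSr ltn_pmul2l ?expn_gt0.
  by rewrite leq_pexp2l.
pose W := words N (size fs).
have sW : size W = (N ^ size fs)%N := size_words N (size fs).
pose mon (t : T) : 'X_{1..n} :=
  [multinom (if insub i is Some u then val (t u) else 0)%N | i < n].
pose Mx := \matrix_(a < size W, b < #|T|) (word_value fs (nth [::] W a))@_(mon (enum_val b)).
have kn : kermx Mx != 0.
  rewrite -mxrank_eq0 mxrank_ker subn_eq0 -ltnNge.
  by apply: leq_ltn_trans (rank_leq_col _) _; rewrite sW.
have /rowV0Pn [v /sub_kermxP vM v0] := kn.
have /existsP [a va] : [exists a, v 0 a != 0].
  apply: contraR v0 => /existsPn h; apply/eqP/rowP => a; rewrite mxE.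
  by apply/eqP/negPn; apply: h.
pose cf s := if insub (index s W) is Some b then v 0 b else 0.
have cfE (b : 'I_(size W)) : cf (nth [::] W b) = v 0 b.
  rewrite /cf index_uniq ?uniq_words //; case: insubP => [u _ /val_inj -> //|].
  by rewrite ltn_ord.
exists N, cf, (nth [::] W a); split; [by apply: mem_nth|by rewrite cfE|].
move=> m mV; rewrite poly_valueE raddf_sum /= -/W.
have [big|small] := leqP B (mdeg m).
  rewrite big_seq big1 // => s sWs; rewrite mul_mpolyC mcoeffZ.
  rewrite (@memN_msupp_eq0 _ _ _ m) ?mulr0 //; apply: msize_mdeg_ge.
  exact: leq_trans (msize_word fe sWs) big.
have mB i : (m i < B)%N.
  by apply: leq_ltn_trans small; rewrite mdegE (bigD1 i) //= leq_addr.
pose t : T := [ffun u => Ordinal (mB (val u))].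
have em : mon t = m.
  apply/mnmP => i; rewrite mnmE; case: insubP => [u _ <-|]; first by rewrite ffunE.
  by rewrite negbK => /mV ->.
transitivity ((v *m Mx) 0 (enum_rank t)); last by rewrite vM mxE.
rewrite mxE (big_nth [::]) big_mkord; apply: eq_bigr => b _.
by rewrite mul_mpolyC mcoeffZ cfE mxE enum_rankK em.
Qed.

End Dependence.

(** The least prime of a chain contains the variables in V, so a polynomial
    whose coefficients at monomials free of V vanish has its image in it.
    Elements separating the successive primes of a chain of length d + 1 would
    then contradict nonzero_value_chain. *)
Theorem prime_chain_bound (k : fieldType) (n : nat) (A : comNzRingType)
    (pi : {rmorphism {mpoly k[n]} -> A}) d :
  (forall a, exists f, pi f = a) ->
  (forall P, prime_ideal P -> exists2 V : {set 'I_n},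
      (#|~: V| <= d)%N & forall i, i \in V -> pi 'X_i \in P) ->
  forall (P : {pred A}) e c, prime_chain_from P e c -> (e <= d)%N.
Proof.
move=> surj hV P e c [_ pc sc]; rewrite leqNgt; apply/negP => lt.
have [V leV XV] := hV _ (pc e (leqnn e)).
pose pick l (f : {mpoly k[n]}) := (l < e)%N ->
  pi f \in c (e - l.+1)%N /\ pi f \notin c (e - l)%N.
have [F hF] : {F & forall l, pick l (F l)}.
  apply: choice => l; have [le|ge] := ltnP l e; last by exists 0; rewrite /pick ltnNge ge.
  have lt' : (e - l.+1 < e)%N by rewrite ltn_subrL /= (leq_ltn_trans _ le).
  have [_ ns] := sc (e - l.+1)%N lt'.
  have [a ac ac'] : exists2 a, a \in c (e - l.+1)%N & a \notin c (e - l)%N.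
    apply: contrapT => no; apply: ns => a ac; apply/negPn/negP => nac.
    by apply: no; exists a; rewrite // -(subnSK le).
  by have [f ef] := surj a; exists f => _; rewrite ef.
pose fs := mkseq F d.+1.
have sfs : size fs = d.+1 by rewrite size_mkseq.
have [|N [cf [s [sW cs hm]]]] := @poly_value_dependent k n V fs.
  by rewrite sfs ltnS.
have [hI _] := pc e (leqnn e).
pose y := poly_value (mpolyC n (R := k)) N fs cf.
suff yI : pi y \in c e.
  have : pi y \notin c e; last by rewrite yI.
  rewrite poly_value_morph.
  apply: (@nonzero_value_chain k A (pi \o mpolyC n (R := k)) c (map pi fs)) => //.
  - by move=> i /sc [].
  - by rewrite size_map sfs.
  - move=> l; rewrite size_map sfs => ld.
    rewrite (nth_map 0) ?sfs // nth_mkseq //.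
    by apply: hF; apply: leq_ltn_trans lt; rewrite -ltnS.
  - by apply: (poly_value_nonzero _ (s := s)) => //; rewrite size_map.
rewrite [y]mpolyE rmorph_sum big_seq; elim/big_rec: _ => [|m z my zI].
  by case: hI.
apply: ideal_add => //; rewrite -mul_mpolyC rmorphM; apply: ideal_absorb => //.
have [i iV mi] : exists2 i, i \in V & m i != 0%N.
  apply: contrapT => no; move: my; rewrite mcoeff_msupp hm ?eqxx // => i iV.
  by apply/eqP/negPn/negP => mi; apply: no; exists i.
have -> : m = ((m - U_(i)) + U_(i))%MM by rewrite submK // lep1mP.
by rewrite mpolyXD rmorphM; apply: ideal_absorb => //; apply: XV.
Qed.

(** * Depth and codimension in the quotient *)

(** Transfers the regularity statements between a ring and its quotient. *)
Lemma ideal_span_image (B C : comNzRingType) (pi : {rmorphism B -> C})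
    (gens ts : seq B) f :
  (forall c, exists b, pi b = c) ->
  (forall b, pi b = 0 <-> b \in ideal_span gens) ->
  pi f \in ideal_span (map pi ts) <-> f \in ideal_span (gens ++ ts).
Proof.
move=> surj ker.
have subL : {subset ideal_span gens <= ideal_span (gens ++ ts)}.
  by apply: ideal_span_sub => x xg; rewrite mem_ideal_span // mem_cat xg.
split.
  pose P c := forall b, pi b = c -> b \in ideal_span (gens ++ ts).
  move=> h; suff /(_ _ h) : forall c, c \in ideal_span (map pi ts) -> P c by apply.
  apply: ideal_span_ind => [b /ker /subL //|x y hx hy b eb|a _ /mapP [t tT ->] b eb].
    have [u eu] := surj x; rewrite -(subrK u b) ideal_spanD //; last exact: hx.
    by apply: hy; rewrite rmorphB eb eu addrAC subrr add0r.
  have [u eu] := surj a; rewrite -(subrK (u * t) b) ideal_spanD //.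
    by apply/subL/ker; rewrite rmorphB rmorphM eb eu subrr.
  by apply: ideal_spanM; rewrite mem_ideal_span // mem_cat tT orbT.
apply: (@ideal_span_ind _ (fun f => pi f \in ideal_span (map pi ts))) => [|x y|a x].
- by rewrite rmorph0 ideal_span0.
- by rewrite rmorphD; apply: ideal_spanD.
rewrite mem_cat rmorphM => /orP [xg|xt]; apply: ideal_spanM.
  have -> : pi x = 0 by apply/ker/mem_ideal_span.
  exact: ideal_span0.
by rewrite mem_ideal_span ?map_f.
Qed.

Lemma prime_prod (A : comNzRingType) (P : {pred A}) (I : eqType) (r : seq I)
    (Q : pred I) (F : I -> A) :
  prime_ideal P -> \prod_(i <- r | Q i) F i \in P -> exists2 i, Q i & F i \in P.
Proof.
move=> [hP pP]; have [_ P1 _] := hP.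
elim/big_rec: _ => [P1'|i x Qi IH]; first by rewrite P1' in P1.
by case/pP/orP => [FP|/IH //]; exists i.
Qed.

Section Assembly.
Variables (k : fieldType) (n : nat) (D : simplicial_complex 'I_n).
Variables (rt : 'I_n -> 'I_n) (Rt : {set 'I_n}) (fac : 'I_n -> nat -> 'I_n).
Hypothesis graft : grafting D rt Rt fac.

(** The exponent of the facet monomial of G as a Newton product. *)
Definition trace_size (G : {set 'I_n}) i := #|[set j in G | rt j == i]|.

Lemma facet_monomial_newton G : G \in facets D ->
  facet_monomial k G = newton k Rt fac (trace_size G).
Proof.
move=> GD; have [GR pe] := graft_facet graft GD.
rewrite /facet_monomial /newton (partition_big rt (mem Rt)) //=.
apply: eq_bigr => i iR; rewrite -[RHS](big_mkord xpredT (fun l => 'X_(fac i l))).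
have -> : \prod_(0 <= l < trace_size G i) 'X_(fac i l) =
    \prod_(j <- [seq fac i l | l <- iota 0 (trace_size G i)]) ('X_j : {mpoly k[n]}).
  by rewrite big_map /index_iota subn0.
rewrite -(perm_big _ (pe i iR)) big_enum_cond /=; apply: eq_bigl => j.
by rewrite inE andbT.
Qed.

Local Notation A := {ideal_quot (facet_ideal k D)}.

Definition proj : {rmorphism {mpoly k[n]} -> A} := \pi_A%qT.

Lemma proj_surj a : exists f, proj f = a.
Proof. by exists (repr a); apply: reprK. Qed.

Definition facet_gens := [seq trace_size G | G <- enum (facets D)].

Lemma proj_eq0 f : proj f = 0 <-> f \in ideal_span (map (newton k Rt fac) facet_gens).
Proof.
have -> : map (newton k Rt fac) facet_gens =
    [seq facet_monomial k F | F <- enum (facets D)].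
  rewrite -map_comp; apply/eq_in_map => G; rewrite mem_enum => GD /=.
  by rewrite facet_monomial_newton.
rewrite -[_ \in _]/(f \in facet_ideal k D) -[f in f \in _]subr0 Quotient.idealrBE.
by rewrite -[0](rmorph0 proj); split => /eqP.
Qed.

(** The prime contains the product of the variables of each block, hence one of
    them; so the variables in it meet all the blocks. *)
Lemma proj_prime_cover P : prime_ideal P -> exists2 V : {set 'I_n},
  (#|~: V| <= #|~: Rt|)%N & forall i, i \in V -> proj 'X_i \in P.
Proof.
move=> pP; exists [set j | proj 'X_j \in P]; last by move=> i; rewrite inE.
set V := [set _ | _]; rewrite -(leq_add2l #|V|) cardsC -(cardsC Rt) leq_add2r.
apply: leq_trans (leq_imset_card rt _); apply/subset_leq_card/subsetP => i iR.
have [F FD Fi] := graft_block graft iR.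
have F0 : proj (facet_monomial k F) = 0.
  apply/proj_eq0; rewrite facet_monomial_newton //; apply: mem_ideal_span.
  by rewrite map_f // map_f // mem_enum.
have [[P0 _ _] _] := pP.
have [|j jF jP] := @prime_prod _ P _ (index_enum 'I_n) (mem F) (fun i => proj 'X_i) pP.
  by rewrite -rmorph_prod /= -/(facet_monomial k F) F0.
by apply/imsetP; exists j; rewrite ?inE ?Fi.
Qed.

Lemma quotient_noetherian : noetherian A.
Proof.
pose xs := [seq proj 'X_i | i <- enum 'I_n].
apply: (@noetherian_gen_over _ xs _ (proj \o mpolyC n (R := k))).
  exact: noetherian_field.
move=> a; have [f <-] := proj_surj a; apply: mpoly_gen_over => [c|i].
  exact: (gen_over_base xs (proj \o mpolyC n (R := k))).
by apply: gen_over_var; apply/mapP; exists i; rewrite ?mem_enum.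
Qed.

Lemma regular_in_maximal M : maximal_ideal M ->
  exists s : seq A, [/\ regular_sequence s, {subset s <= M} & size s = #|~: Rt|].
Proof.
move=> maxM; have [hM _] := maxM; have [_ M1 _] := hM.
pose good j (p : {poly k}) := p \is monic /\
  proj (map_poly (mpolyC n (R := k)) p).[theta k rt j] \in M.
have [q hq] : {q & forall j, good j (q j)}.
  apply: choice => j.
  by have [p mp pM] := maximal_algebraic (theta k rt j) proj_surj maxM; exists p.
have q_monic j : j \notin Rt -> q j \is monic by case: (hq j).
have q_size j : j \notin Rt -> (1 < size (q j))%N.
  move=> _; have [mq qM] := hq j; rewrite ltnNge; apply/negP => /size1_polyC e.
  move: e mq qM; set a := (q j)`_0 => ->; rewrite monicE lead_coefC => /eqP ->.
  rewrite map_polyC hornerC -[proj _]/((proj \o mpolyC n (R := k)) 1) rmorph1.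
  by rewrite (negPf M1).
pose ts := enum (~: Rt).
have tsR j : j \in ts -> j \notin Rt by rewrite mem_enum inE.
exists [seq proj (qval rt q j) | j <- ts].
rewrite size_map -cardE; split=> //; last first.
  by move=> _ /mapP [j _ ->]; case: (hq j).
split; last first.
  apply: contra M1; apply: ideal_span_in; try by case: hM.
  by move=> _ /mapP [j _ ->]; case: (hq j).
move=> i; rewrite size_map => lti y.
have [f <-] := proj_surj y.
have j0 : 'I_n by move: lti; case: (ts).
rewrite (nth_map j0) // -map_take -rmorphM (map_comp proj).
set j := nth j0 ts i; set us := take i ts.
have usR : {in us, forall j, j \notin Rt} by move=> u /mem_take /tsR.
have jus : j \notin us.
  have := enum_uniq (~: Rt); rewrite -/ts -(cat_take_drop i ts) (drop_nth j0 lti).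
  by rewrite cat_uniq /= negb_or => /and3P [_ /andP []].
rewrite !(ideal_span_image _ _ proj_surj proj_eq0).
apply: (qval_regular (graft_rt graft) (graft_root graft) (graft_fac graft)) => //.
by apply: tsR; apply: mem_nth.
Qed.

Lemma quotient_cohen_macaulay : cohen_macaulay A.
Proof.
split; first exact: quotient_noetherian.
move=> M maxM; exists #|~: Rt|; have pM := maximal_prime maxM.
have bound := prime_chain_bound proj_surj proj_prime_cover.
have [s [rs sM ss]] := regular_in_maximal maxM.
split; split.
- by exists s.
- move=> t rt' tM; have [c hc] := regular_sequence_chain pM rt' tM.
  exact: bound hc.
- by rewrite -ss; apply: regular_sequence_chain.
- by move=> e c; apply: bound.
Qed.

End Assembly.

(** Depth and codimension of every maximal ideal equal the number of variables
    that are not roots of blocks. *)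
Theorem corollary5p8 (k : fieldType) (n : nat) (D : simplicial_complex 'I_n)
    (treeD : tree D) (unmixedD : unmixed D) :
  cohen_macaulay {ideal_quot (facet_ideal k D)}.
Proof.
have [rt [Rt [fac graft]]] := unmixed_tree_grafting treeD unmixedD.
exact: quotient_cohen_macaulay graft.
Qed.
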